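(* Let $A$ be a finite dimensional weak $C^*$-Hopf algebra with normalized Haar integral $h$, let $l\in\mathcal L(A)$ be a positive left integral, put $e_l:=d_R(l)^{1/2}\,h\,d_R(l)^{1/2}$, and assume there exists $\lambda\in\hat A$ satisfying $\lambda\rightharpoonup e_l=1$. Then $l$ is nondegenerate and $\lambda$ is uniquely determined. Moreover, $\lambda$ is a positive and nondegenerate left integral in $\hat A$.
   Context: A finite dimensional weak $C^*$-Hopf algebra is a finite dimensional $C^*$-algebra $A$ (unit $1$) with linear maps $\Delta:A\to A\otimes A$, $\varepsilon:A\to\mathbb C$, $S:A\to A$ such that, for all $x,y,z\in A$ in Sweedler notation: $\Delta(xy)=\Delta(x)\Delta(y)$; $\Delta(x^* )=\Delta(x)^*$; $(\Delta\otimes\mathrm{id})\Delta=(\mathrm{id}\otimes\Delta)\Delta$; $(\Delta(1)\otimes1)(1\otimes\Delta(1))=1_{(1)}\otimes1_{(2)}\otimes1_{(3)}$; $(\varepsilon\otimes\mathrm{id})\Delta=\mathrm{id}=(\mathrm{id}\otimes\varepsilon)\Delta$; $\varepsilon(xyz)=\varepsilon(xy_{(1)})\varepsilon(y_{(2)}z)$; $S(x_{(1)})x_{(2)}=1_{(1)}\varepsilon(x1_{(2)})$; $x_{(1)}S(x_{(2)})=\varepsilon(1_{(1)}x)1_{(2)}$; $S(x_{(1)})x_{(2)}S(x_{(3)})=S(x)$. ($\Delta(1)\neq 1\otimes 1$ in general; $S$ is automatically invertible.) Put $x_*:=S(x)^*$. The dual $\hat A$ is the dual vector space with $\langle\psi\varphi|x\rangle=\langle\psi\otimes\varphi|\Delta(x)\rangle$,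 $\langle\hat\Delta(\psi)|x\otimes y\rangle=\langle\psi|xy\rangle$, $\hat1=\varepsilon$, $\hat\varepsilon(\psi)=\langle\psi|1\rangle$, $\langle\hat S(\psi)|x\rangle=\langle\psi|S(x)\rangle$, $\langle\psi^*|x\rangle=\overline{\langle\psi|x_*\rangle}$; it is again a finite dimensional weak $C^*$-Hopf algebra, with dual $A$. Write $\varphi\rightharpoonup a=a_{(1)}\langle\varphi|a_{(2)}\rangle$. $A_R=\{(\mathrm{id}\otimes\varphi)(\Delta(1)):\varphi\in\hat A\}$, a unital $*$-subalgebra of $A$. Integrals (the same notions apply to $\hat A$ with $A=\hat{\hat A}$): $l\in A$ is a left integral ($l\in\mathcal L(A)$) if $al=a_{(1)}S(a_{(2)})l$ for all $a\in A$; a right integral if $la=lS(a_{(1)})a_{(2)}$ for all $a$. $h$ is the unique two-sided integral with $S(h_{(1)})h_{(2)}=h_{(1)}S(h_{(2)})=1$. A left integral $l$ is positive if $\langle l|\varphi^*\varphi\rangle\ge0$ for all $\varphi\in\hat A$, and nondegenerate if the bilinear form $(\varphi,\psi)\mapsto\langle l|\varphi\psi\rangle$ on $\hat A$ is nondegenerate. $d_R(l)=S(l_{(1)})l_{(2)}\in A_R$ (with $d_R(l)\ge0$ if $l$ is positive). *)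

(* Defs.v *)
From HB Require Import structures.
From mathcomp Require Import all_boot all_order all_algebra all_field.
From mathcomp Require Import complex.
From mathcomp Require Import boolp classical_sets reals.

Set Implicit Arguments.
Unset Strict Implicit.
Unset Printing Implicit Defensive.

Import Order.TTheory GRing.Theory Num.Theory.

Local Open Scope ring_scope.

Section TensorProduct.
Variables (K : fieldType) (U V : vectType K).

(* U (x) V, as coordinate matrices with respect to the bases vbasis {:U} and
   vbasis {:V}; only [tensor] and [sweedler] refer to the coordinates. *)
Definition tens : Type := 'M[K]_(\dim {:U}, \dim {:V}).
HB.instance Definition _ := Vector.copy tens 'M[K]_(\dim {:U}, \dim {:V}).

Definition tensor (u : U) (v : V) : tens :=
  \matrix_(i, j) (coord (vbasis {:U}) i u * coord (vbasis {:V}) j v).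

(* For bilinear F, [sweedler t F] is the value at t of the linear map induced
   by F on U (x) V: the "sum of the F t_(1) t_(2)". *)
Definition sweedler (W : lmodType K) (t : tens) (F : U -> V -> W) : W :=
  \sum_i \sum_j t i j *: F (vbasis {:U})`_i (vbasis {:V})`_j.

Fact sweedler_is_linear (W : lmodType K) (F : U -> V -> W) :
  linear (fun t : tens => sweedler t F).
Proof.
move=> a t s; rewrite /sweedler scaler_sumr -big_split /=; apply: eq_bigr => i _.
rewrite scaler_sumr -big_split /=; apply: eq_bigr => j _.
by rewrite !mxE scalerDl scalerA.
Qed.

Lemma sweedler_tensor (W : lmodType K) (F : U -> V -> W) u v :
  (forall v, linear (F^~ v)) -> (forall u, linear (F u)) ->
  sweedler (tensor u v) F = F u v.
Proof.
move=> Fl Fr.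
pose FL v : {linear U -> W} := HB.pack (F^~ v)
  (GRing.isLinear.Build K U W _ (F^~ v) (Fl v)).
pose FR u : {linear V -> W} := HB.pack (F u)
  (GRing.isLinear.Build K V W _ (F u) (Fr u)).
rewrite -[F u v]/(FL v u) [u in RHS](coord_vbasis (memvf u)) linear_sum.
apply: eq_bigr => i _; rewrite linearZ_LR -[FL v _]/(FR _ v).
rewrite [v in RHS](coord_vbasis (memvf v)) linear_sum scaler_sumr.
by apply: eq_bigr => j _; rewrite mxE linearZ_LR scalerA.
Qed.

Lemma sweedlerE (t : tens) : sweedler t tensor = t.
Proof.
apply/matrixP => k l; rewrite /sweedler summxE.
rewrite (bigD1 k) //= [X in _ + X]big1 ?addr0 => [|i nik].
  rewrite summxE (bigD1 l) //= [X in _ + X]big1 ?addr0 => [|j njl].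
    by rewrite !mxE !coord_free ?(basis_free (vbasisP _)) // !eqxx !mulr1.
  rewrite !mxE !coord_free ?(basis_free (vbasisP _)) //.
  by rewrite (negPf njl) !mulr0.
rewrite summxE big1 // => j _.
rewrite !mxE !coord_free ?(basis_free (vbasisP _)) //.
by rewrite (negPf nik) !mul0r mulr0.
Qed.

End TensorProduct.

Notation "x ⊗ y" := (tensor x y) (at level 40, left associativity).
Notation "'\sw_' ( x , y '<-' t ) F" := (sweedler t (fun x y => F))
  (at level 41, x name, y name, t at level 60, F at level 41,
   format "'\sw_' ( x ,  y  '<-'  t )  F").

Section SweedlerTheory.
Variables (K : fieldType) (U V : vectType K).

Lemma eq_sweedler (W : lmodType K) (t : tens U V) (F G : U -> V -> W) :
  (forall x y, F x y = G x y) -> sweedler t F = sweedler t G.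
Proof. by move=> e; apply: eq_bigr => i _; apply: eq_bigr => j _; rewrite e. Qed.

Lemma linear_sweedler (W W' : lmodType K) (f : {linear W -> W'})
    (t : tens U V) (F : U -> V -> W) :
  f (sweedler t F) = \sw_(x, y <- t) f (F x y).
Proof.
rewrite linear_sum; apply: eq_bigr => i _; rewrite linear_sum.
by apply: eq_bigr => j _; rewrite linearZ_LR.
Qed.

Lemma sweedlerDr (W : lmodType K) (a : K) (t : tens U V) (F G : U -> V -> W) :
  \sw_(x, y <- t) (a *: F x y + G x y) = a *: sweedler t F + sweedler t G.
Proof.
rewrite /sweedler scaler_sumr -big_split /=; apply: eq_bigr => i _.
rewrite scaler_sumr -big_split /=; apply: eq_bigr => j _.
by rewrite scalerDr !scalerA mulrC.
Qed.

Fact tensor_linearl (v : V) : linear (fun u : U => u ⊗ v).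
Proof. by move=> a x y; apply/matrixP => i j; rewrite !mxE linearP mulrDl -mulrA. Qed.

Fact tensor_linearr (u : U) : linear (fun v : V => u ⊗ v).
Proof. by move=> a x y; apply/matrixP => i j; rewrite !mxE linearP mulrDr mulrCA. Qed.

End SweedlerTheory.

HB.mixin Record isCoalgebra (K : fieldType) A of Vector K A := {
  cop : {linear A -> tens A A};
  counit : {scalar A};
  coassoc : forall x : A,
    \sw_(x1, x2 <- cop x) \sw_(y1, y2 <- cop x1) y1 ⊗ (y2 ⊗ x2)
    = \sw_(x1, x2 <- cop x) \sw_(y1, y2 <- cop x2) x1 ⊗ (y1 ⊗ y2);
  counitl : forall x : A, \sw_(x1, x2 <- cop x) (counit x1 *: x2) = x;
  counitr : forall x : A, \sw_(x1, x2 <- cop x) (counit x2 *: x1) = x }.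

#[short(type="coalgType")]
HB.structure Definition Coalgebra (K : fieldType) :=
  { A of isCoalgebra K A & Vector K A }.

HB.mixin Record hasStar (C : numClosedFieldType) A of Vector C A := {
  star : A -> A;
  starDZ : forall (a : C) (x y : A), star (a *: x + y) = a^* *: star x + star y }.

#[short(type="starVectType")]
HB.structure Definition StarVector (C : numClosedFieldType) :=
  { A of hasStar C A & Vector C A }.

#[short(type="starAlgType")]
HB.structure Definition StarAlgebra (C : numClosedFieldType) :=
  { A of hasStar C A & Falgebra C A }.

(* The norm is not taken from normedModType: the library has no structure that is
   both a normed zmodType and a ring, except its numDomainTypes.
   It is C-valued; the axioms make it real and nonnegative. *)
HB.mixin Record isCstarAlgebra (C : numClosedFieldType) A
    of StarAlgebra C A := {
  starK : involutive (star : A -> A);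
  starM : forall x y : A, star (x * y) = star y * star x;
  cnorm : A -> C;
  cnorm0_eq0 : forall x : A, cnorm x = 0 -> x = 0;
  cnormD : forall x y : A, cnorm (x + y) <= cnorm x + cnorm y;
  cnormZ : forall (a : C) (x : A), cnorm (a *: x) = `|a| * cnorm x;
  cnormM : forall x y : A, cnorm (x * y) <= cnorm x * cnorm y;
  cnorm_star : forall x : A, cnorm (star x * x) = cnorm x ^+ 2;
  cnorm_complete : forall u : nat -> A,
    (forall e : C, 0 < e -> exists N : nat, forall m n : nat,
       (N <= m)%N -> (N <= n)%N -> cnorm (u m - u n) < e) ->
    exists x : A, forall e : C, 0 < e -> exists N : nat, forall n : nat,
       (N <= n)%N -> cnorm (u n - x) < e }.

#[short(type="finCstarType")]
HB.structure Definition FinCstarAlgebra (C : numClosedFieldType) :=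
  { A of isCstarAlgebra C A & StarAlgebra C A }.

HB.mixin Record hasAntipode (C : numClosedFieldType) A of Vector C A := {
  antipode : {linear A -> A} }.

(* The operations of a weak C^*-Hopf algebra, with no compatibility between the
   algebra, the coalgebra, the star and the antipode. This is all that is needed
   to speak of integrals, and to build the dual with the same operations. *)
#[short(type="preHopfType")]
HB.structure Definition PreHopf (C : numClosedFieldType) :=
  { A of hasAntipode C A & Coalgebra C A & StarAlgebra C A }.

(* The involution of A (x) A with (x (x) y)^* = x^* (x) y^*. *)
Definition star_tens (C : numClosedFieldType) (A : starVectType C)
    (t : tens A A) : tens A A :=
  \sum_i \sum_j (t i j)^* *: (star (vbasis {:A})`_i ⊗ star (vbasis {:A})`_j).

Lemma star_sum (C : numClosedFieldType) (A : starVectType C) (n : nat)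
    (c : 'I_n -> C) (F : 'I_n -> A) :
  star (\sum_i c i *: F i) = \sum_i (c i)^* *: star (F i).
Proof.
have star0 : star 0 = 0 :> A.
  apply: (addrI (star 0)); have := starDZ 1 (0 : A) 0.
  by rewrite !addr0 scaler0 rmorph1 scale1r => <-.
apply: (big_ind2 (fun x y => star x = y)) => // [x x' y y' <- <-|i _].
  by rewrite -[x in LHS]scale1r starDZ rmorph1 scale1r.
by rewrite -[_ *: _ in LHS]addr0 starDZ star0 addr0.
Qed.

Lemma star_tensE (C : numClosedFieldType) (A : starVectType C) (x y : A) :
  star_tens (x ⊗ y) = star x ⊗ star y.
Proof.
rewrite [in RHS](coord_vbasis (memvf x)) star_sum.
rewrite [in RHS](coord_vbasis (memvf y)) star_sum.
apply/matrixP => k l; rewrite !mxE !linear_sum /= mulr_suml summxE.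
apply: eq_bigr => i _; rewrite mulr_sumr summxE; apply: eq_bigr => j _.
by rewrite !mxE !linearZ /= rmorphM mulrACA.
Qed.

HB.mixin Record isWeakHopf (C : numClosedFieldType) A of PreHopf C A := {
  copM : forall x y : A, cop (x * y) =
    \sw_(x1, x2 <- cop x) \sw_(y1, y2 <- cop y) (x1 * y1) ⊗ (x2 * y2);
  cop_star : forall x : A, cop (star x) = star_tens (cop x);
  cop1 :
    \sw_(a1, a2 <- cop (1 : A)) \sw_(b1, b2 <- cop (1 : A)) a1 ⊗ ((a2 * b1) ⊗ b2)
    = \sw_(a1, a2 <- cop (1 : A)) \sw_(b1, b2 <- cop a2) a1 ⊗ (b1 ⊗ b2);
  counitM : forall x y z : A, counit (x * y * z) =
    \sw_(y1, y2 <- cop y) (counit (x * y1) * counit (y2 * z) : C^o);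
  antipodel : forall x : A, \sw_(x1, x2 <- cop x) (antipode x1 * x2) =
    \sw_(a1, a2 <- cop (1 : A)) (counit (x * a2) *: a1);
  antipoder : forall x : A, \sw_(x1, x2 <- cop x) (x1 * antipode x2) =
    \sw_(a1, a2 <- cop (1 : A)) (counit (a1 * x) *: a2);
  antipodem : forall x : A,
    \sw_(x1, y <- cop x) \sw_(x2, x3 <- cop y) (antipode x1 * x2 * antipode x3)
    = antipode x }.

#[short(type="weakCstarHopfType")]
HB.structure Definition WeakCstarHopf (C : numClosedFieldType) :=
  { A of isWeakHopf C A & PreHopf C A & FinCstarAlgebra C A }.

Section Dual.
Variable K : fieldType.

Definition dual (A : vectType K) : Type := 'Hom(A, K^o).
HB.instance Definition _ (A : vectType K) := Vector.copy (dual A) 'Hom(A, K^o).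

Definition pairing (A : vectType K) (phi : dual A) (x : A) : K :=
  (phi : 'Hom(A, K^o)) x.

End Dual.

Section PairingTheory.
Variables (K : fieldType) (A : vectType K).
Implicit Types (phi psi : dual A) (x y : A).

Lemma pairing_inj phi psi : pairing phi =1 pairing psi -> phi = psi.
Proof. by move=> e; apply/lfunP. Qed.

Lemma pairingDl a phi psi x :
  pairing (a *: phi + psi) x = a * pairing phi x + pairing psi x.
Proof. by rewrite /pairing [LHS]add_lfunE scale_lfunE. Qed.

Lemma pairingDr a phi x y :
  pairing phi (a *: x + y) = a * pairing phi x + pairing phi y.
Proof. by rewrite /pairing linearP. Qed.

Lemma pairingZr a phi x : pairing phi (a *: x) = a * pairing phi x.
Proof. by rewrite /pairing linearZ. Qed.

Lemma pairing_sumr (I : Type) (r : seq I) (P : pred I) (F : I -> A) phi :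
  pairing phi (\sum_(i <- r | P i) F i) = \sum_(i <- r | P i) pairing phi (F i).
Proof. by rewrite /pairing linear_sum. Qed.

End PairingTheory.

Section DualAlgebra.
Variables (K : fieldType) (A : coalgType K).
Implicit Types (phi psi chi : dual A) (x : A).

Definition dual_mul phi psi : dual A :=
  linfun (fun x => \sw_(x1, x2 <- cop x) (pairing phi x1 * pairing psi x2 : K^o)).

Definition dual_one : dual A := linfun (counit : A -> K^o).

Lemma pairing_mul phi psi x : pairing (dual_mul phi psi) x =
  \sw_(x1, x2 <- cop x) (pairing phi x1 * pairing psi x2 : K^o).
Proof.
pose f x : K^o := \sw_(x1, x2 <- cop x) (pairing phi x1 * pairing psi x2 : K^o).
have f_lin : linear f by move=> a y z; rewrite /f linearP sweedler_is_linear.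
pose F : {linear A -> K^o} := HB.pack f (GRing.isLinear.Build K A K^o _ f f_lin).
exact: (lfunE F).
Qed.

Lemma pairing_one x : pairing dual_one x = counit x.
Proof. exact: (lfunE (counit : {linear A -> K^o})). Qed.

Fact dual_mulA : associative dual_mul.
Proof.
move=> phi psi chi; apply: pairing_inj => x; rewrite !pairing_mul.
have pA (f g : dual A) : forall y, linear (fun x : A => pairing f x * pairing g y : K^o).
  by move=> y a u v; rewrite pairingDr mulrDl -mulrA.
have pB (f g : dual A) : forall x, linear (fun y : A => pairing f x * pairing g y : K^o).
  by move=> y a u v; rewrite pairingDr mulrDr mulrCA.
pose L1 (t : tens A A) : K^o := \sw_(b, c <- t) (pairing psi b * pairing chi c : K^o).
pose L (t : tens A (tens A A)) : K^o := \sw_(a, s <- t) (pairing phi a * L1 s : K^o).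
have L_lin : linear L by move=> a s t; exact: sweedler_is_linear.
pose LL : {linear tens A (tens A A) -> K^o} :=
  HB.pack L (GRing.isLinear.Build K _ K^o _ L L_lin).
have LE a b c : L (a ⊗ (b ⊗ c)) = pairing phi a * (pairing psi b * pairing chi c).
  rewrite /L sweedler_tensor.
  - by rewrite /L1 (sweedler_tensor _ _ (pA _ _) (pB _ _)).
  - by move=> t d u v; rewrite pairingDr mulrDl -mulrA.
  - by move=> u d s t; rewrite /L1 sweedler_is_linear mulrDr mulrCA.
have := congr1 LL (coassoc x); rewrite !linear_sweedler => e.
transitivity (\sw_(x1, x2 <- cop x) LL (\sw_(y1, y2 <- cop x2) x1 ⊗ (y1 ⊗ y2))).
  apply: (@eq_sweedler _ _ _ K^o) => x1 x2; rewrite pairing_mul linear_sweedler.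
  under [RHS]eq_sweedler do rewrite [LL _]LE.
  by rewrite /sweedler mulr_sumr; apply: eq_bigr => i _; rewrite mulr_sumr;
     apply: eq_bigr => j _; rewrite [LHS]mulrCA.
rewrite -e; apply: (@eq_sweedler _ _ _ K^o) => x1 x2; rewrite pairing_mul linear_sweedler.
under eq_sweedler do rewrite [LL _]LE.
rewrite /sweedler mulr_suml; apply: eq_bigr => i _; rewrite mulr_suml.
by apply: eq_bigr => j _; rewrite -[RHS]mulrA -!mulrA.
Qed.

Fact dual_mul1l : left_id dual_one dual_mul.
Proof.
move=> phi; apply: pairing_inj => x; rewrite pairing_mul.
rewrite -[in RHS](counitl x) /pairing linear_sweedler.
by apply: (@eq_sweedler _ _ _ K^o) => x1 x2; rewrite -/(pairing _ _) pairing_one linearZ_LR.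
Qed.

Fact dual_mul1r : right_id dual_one dual_mul.
Proof.
move=> phi; apply: pairing_inj => x; rewrite pairing_mul.
rewrite -[in RHS](counitr x) /pairing linear_sweedler.
apply: (@eq_sweedler _ _ _ K^o) => x1 x2.
by rewrite -/(pairing dual_one _) pairing_one linearZ_LR [LHS]mulrC.
Qed.

Lemma dual_mulDZl a phi psi chi :
  dual_mul (a *: phi + psi) chi = a *: dual_mul phi chi + dual_mul psi chi.
Proof.
apply: pairing_inj => x; rewrite pairingDl !pairing_mul.
rewrite -[RHS]/(a *: (_ : K^o) + _) -sweedlerDr; apply: (@eq_sweedler _ _ _ K^o) => x1 x2.
by rewrite pairingDl mulrDl -mulrA.
Qed.

Lemma dual_mulDZr a phi psi chi :
  dual_mul chi (a *: phi + psi) = a *: dual_mul chi phi + dual_mul chi psi.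
Proof.
apply: pairing_inj => x; rewrite pairingDl !pairing_mul.
rewrite -[RHS]/(a *: (_ : K^o) + _) -sweedlerDr; apply: (@eq_sweedler _ _ _ K^o) => x1 x2.
by rewrite pairingDl mulrDr mulrCA.
Qed.

Fact dual_mulDl : left_distributive dual_mul +%R.
Proof. by move=> f g k; have := dual_mulDZl 1 f g k; rewrite !scale1r. Qed.

Fact dual_mulDr : right_distributive dual_mul +%R.
Proof. by move=> k f g; have := dual_mulDZr 1 f g k; rewrite !scale1r. Qed.

Lemma dual_mul0l phi : dual_mul 0 phi = 0.
Proof. by apply: (addIr (dual_mul 0 phi)); rewrite -dual_mulDl !add0r. Qed.

Lemma dual_mul0r phi : dual_mul phi 0 = 0.
Proof. by apply: (addIr (dual_mul phi 0)); rewrite -dual_mulDr !add0r. Qed.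

Fact dual_scaleAl a phi psi : a *: dual_mul phi psi = dual_mul (a *: phi) psi.
Proof. by have := dual_mulDZl a phi 0 psi; rewrite dual_mul0l !addr0. Qed.

Fact dual_scaleAr a phi psi : a *: dual_mul phi psi = dual_mul phi (a *: psi).
Proof. by have := dual_mulDZr a psi 0 phi; rewrite dual_mul0r !addr0. Qed.

End DualAlgebra.

Section DualCoalgebra.
Variables (K : fieldType) (A : falgType K).
Implicit Types (phi : dual A) (x y : A).

Local Notation e i := (vbasis {:A})`_i.
Local Notation n := (\dim {:A}).

Definition dual_basis (i : 'I_n) : dual A := linfun (coord (vbasis {:A}) i : A -> K^o).

(* The unique tensor with <dual_cop phi | x (x) y> = <phi | x * y>,
   see pairing_cop below. *)
Definition dual_cop phi : tens (dual A) (dual A) :=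
  \sum_(i < n) \sum_(j < n) pairing phi (e i * e j) *: (dual_basis i ⊗ dual_basis j).

Definition dual_counit phi : K := pairing phi 1.

Fact dual_cop_is_linear : linear dual_cop.
Proof.
move=> a f g; rewrite /dual_cop scaler_sumr -big_split /=; apply: eq_bigr => i _.
rewrite scaler_sumr -big_split /=; apply: eq_bigr => j _.
by rewrite pairingDl scalerDl scalerA.
Qed.
HB.instance Definition _ := GRing.isLinear.Build K (dual A)
  (tens (dual A) (dual A)) _ dual_cop dual_cop_is_linear.

Fact dual_counit_is_linear : scalar dual_counit.
Proof. by move=> a f g; rewrite /dual_counit pairingDl. Qed.
HB.instance Definition _ := GRing.isLinear.Build K (dual A)
  K _ dual_counit dual_counit_is_linear.

Lemma pairing_dual_basis i x : pairing (dual_basis i) x = coord (vbasis {:A}) i x.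
Proof. exact: (lfunE (coord (vbasis {:A}) i : {linear A -> K^o})). Qed.

Lemma dual_basis_expand phi : phi = \sum_(i < n) pairing phi (e i) *: dual_basis i.
Proof.
apply: pairing_inj => x; rewrite [in LHS](coord_vbasis (memvf x)).
rewrite /pairing linear_sum sum_lfunE; apply: eq_bigr => i _.
by rewrite linearZ_LR scale_lfunE -/(pairing (dual_basis i) x) pairing_dual_basis
   [LHS]mulrC.
Qed.

Lemma sweedler_dual_cop (W : lmodType K) (F : dual A -> dual A -> W) phi :
  (forall g, linear (F^~ g)) -> (forall f, linear (F f)) ->
  sweedler (dual_cop phi) F =
    \sum_(i < n) \sum_(j < n) pairing phi (e i * e j) *: F (dual_basis i) (dual_basis j).
Proof.
move=> Fl Fr.
pose s (t : tens (dual A) (dual A)) := sweedler t F.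
have s_lin : linear s by exact: sweedler_is_linear.
pose S : {linear _ -> W} := HB.pack s (GRing.isLinear.Build K _ W _ s s_lin).
rewrite -[LHS]/(S _) linear_sum; apply: eq_bigr => i _.
rewrite linear_sum; apply: eq_bigr => j _.
by rewrite linearZ_LR -[S _]/(s _) /s sweedler_tensor.
Qed.

Lemma pairing_cop phi x y :
  \sw_(f, g <- dual_cop phi) (pairing f x * pairing g y : K^o)
  = pairing phi (x * y).
Proof.
rewrite sweedler_dual_cop.
- have -> : x * y = \sum_(i < n) \sum_(j < n)
      (coord (vbasis {:A}) i x * coord (vbasis {:A}) j y) *: (e i * e j).
    rewrite {1}(coord_vbasis (memvf x)) mulr_suml; apply: eq_bigr => i _.
    rewrite {1}(coord_vbasis (memvf y)) mulr_sumr; apply: eq_bigr => j _.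
    by rewrite -scalerAl -scalerAr scalerA.
  rewrite pairing_sumr; apply: eq_bigr => i _.
  rewrite pairing_sumr; apply: eq_bigr => j _.
  by rewrite pairingZr !pairing_dual_basis [LHS]mulrC.
- by move=> g a u v; rewrite pairingDl mulrDl -mulrA.
- by move=> g a u v; rewrite pairingDl mulrDr mulrCA.
Qed.

Fact dual_coassoc phi :
  \sw_(f, g <- dual_cop phi) \sw_(f1, f2 <- dual_cop f) f1 ⊗ (f2 ⊗ g)
  = \sw_(f, g <- dual_cop phi) \sw_(g1, g2 <- dual_cop g) f ⊗ (g1 ⊗ g2).
Proof.
have sl (W : lmodType K) (F : dual A -> dual A -> W) :
    linear (fun f => sweedler (dual_cop f) F).
  by move=> a f g; rewrite linearP sweedler_is_linear.
pose T i j k := dual_basis i ⊗ (dual_basis j ⊗ dual_basis k).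
transitivity (\sum_(j < n) \sum_(k < n) \sum_(l < n)
    pairing phi (e k * e l * e j) *: T k l j).
  rewrite sweedler_dual_cop; first last.
  - move=> f a u v; rewrite -sweedlerDr; apply: eq_sweedler => x y.
    by rewrite !tensor_linearr.
  - by move=> g; exact: sl.
  rewrite exchange_big; apply: eq_bigr => j _.
  have E i : \sw_(f1, f2 <- dual_cop (dual_basis i)) f1 ⊗ (f2 ⊗ dual_basis j) =
     \sum_(k < n) \sum_(l < n) pairing (dual_basis i) (e k * e l) *: T k l j.
    rewrite sweedler_dual_cop // => [g|f] a u v; first by rewrite tensor_linearl.
    by rewrite tensor_linearl tensor_linearr.
  under eq_bigr do rewrite E scaler_sumr.
  rewrite exchange_big; apply: eq_bigr => k _.
  under eq_bigr do rewrite scaler_sumr.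
  rewrite exchange_big; apply: eq_bigr => l _.
  under eq_bigr do rewrite scalerA pairing_dual_basis.
  rewrite -scaler_suml; congr (_ *: _).
  rewrite [X in _ = pairing phi (X * _)](coord_vbasis (memvf (e k * e l))).
  rewrite mulr_suml pairing_sumr; apply: eq_bigr => i _.
  by rewrite -scalerAl pairingZr mulrC.
rewrite sweedler_dual_cop; first last.
- by move=> f; exact: sl.
- move=> g a u v; rewrite -sweedlerDr; apply: eq_sweedler => x y.
  by rewrite !tensor_linearl.
rewrite exchange_big; apply: eq_bigr => k _ /=; rewrite exchange_big /=.
have E j : \sw_(g1, g2 <- dual_cop (dual_basis j)) dual_basis k ⊗ (g1 ⊗ g2) =
   \sum_(l < n) \sum_(m < n) pairing (dual_basis j) (e l * e m) *: T k l m.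
  rewrite sweedler_dual_cop // => [g|f] a u v.
    by rewrite tensor_linearl tensor_linearr.
  by rewrite !tensor_linearr.
under [RHS]eq_bigr do rewrite E scaler_sumr.
rewrite [RHS]exchange_big; apply: eq_bigr => l _ /=.
under [RHS]eq_bigr do rewrite scaler_sumr.
rewrite [RHS]exchange_big; apply: eq_bigr => m _.
under [RHS]eq_bigr do rewrite scalerA pairing_dual_basis.
rewrite -scaler_suml; congr (_ *: _).
rewrite -mulrA [X in pairing phi (_ * X) = _](coord_vbasis (memvf (e l * e m))).
rewrite mulr_sumr pairing_sumr; apply: eq_bigr => j _.
by rewrite -scalerAr pairingZr mulrC.
Qed.

Fact dual_counitl phi :
  \sw_(f, g <- dual_cop phi) (dual_counit f *: g) = phi.
Proof.
rewrite sweedler_dual_cop => [|g a u v|f a u v]; first last.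
- by rewrite scalerDr !scalerA mulrC.
- by rewrite linearP scalerDl scalerA.
rewrite exchange_big [RHS]dual_basis_expand; apply: eq_bigr => j _ /=.
under eq_bigr do rewrite scalerA; rewrite -scaler_suml; congr (_ *: _).
rewrite -[X in _ = pairing phi X]mul1r (coord_vbasis (memvf 1)).
rewrite mulr_suml pairing_sumr; apply: eq_bigr => i _.
by rewrite -scalerAl pairingZr mulrC /dual_counit pairing_dual_basis.
Qed.

Fact dual_counitr phi :
  \sw_(f, g <- dual_cop phi) (dual_counit g *: f) = phi.
Proof.
rewrite sweedler_dual_cop => [|g a u v|f a u v]; first last.
- by rewrite linearP scalerDl scalerA.
- by rewrite scalerDr !scalerA mulrC.
rewrite [RHS]dual_basis_expand; apply: eq_bigr => i _ /=.
under eq_bigr do rewrite scalerA; rewrite -scaler_suml; congr (_ *: _).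
rewrite -[X in _ = pairing phi X]mulr1 (coord_vbasis (memvf 1)).
rewrite mulr_sumr pairing_sumr; apply: eq_bigr => j _.
by rewrite -scalerAr pairingZr mulrC /dual_counit pairing_dual_basis.
Qed.

End DualCoalgebra.

HB.instance Definition _ (K : fieldType) (A : falgType K) :=
  isCoalgebra.Build K (dual A) (@dual_coassoc K A) (@dual_counitl K A)
    (@dual_counitr K A).

Section DualHopf.
Variables (C : numClosedFieldType) (A : preHopfType C).
Implicit Types (phi psi : dual A) (x : A).

Fact dual_one_neq0 : dual_one A != 0.
Proof.
apply: contraNneq (oner_neq0 A) => e0.
have c0 (x : A) : counit x = 0 by rewrite -pairing_one e0 /pairing [LHS]zero_lfunE.
rewrite -(counitl (1 : A)) /sweedler big1 // => i _.
by rewrite big1 // => j _; rewrite c0 scale0r scaler0.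
Qed.

HB.instance Definition _ := GRing.Zmodule_isNzRing.Build (dual A)
  (@dual_mulA C A) (@dual_mul1l C A) (@dual_mul1r C A) (@dual_mulDl C A)
  (@dual_mulDr C A) dual_one_neq0.
HB.instance Definition _ := GRing.Lmodule_isLalgebra.Build C (dual A)
  (@dual_scaleAl C A).
HB.instance Definition _ := GRing.Lalgebra_isAlgebra.Build C (dual A)
  (@dual_scaleAr C A).
HB.instance Definition _ := Algebra_isFalgebra.Build C (dual A).

Definition dual_antipode phi : dual A :=
  linfun (fun x => pairing phi (antipode x) : C^o).

Lemma pairing_antipode phi x :
  pairing (dual_antipode phi) x = pairing phi (antipode x).
Proof.
pose f (x : A) : C^o := pairing phi (antipode x).
have f_lin : linear f by move=> a y z; rewrite /f linearP pairingDr.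
pose F : {linear A -> C^o} := HB.pack f (GRing.isLinear.Build C A C^o _ f f_lin).
exact: (lfunE F).
Qed.

Fact dual_antipode_is_linear : linear dual_antipode.
Proof.
move=> a f g; apply: pairing_inj => x.
by rewrite pairingDl !pairing_antipode pairingDl.
Qed.
HB.instance Definition _ := GRing.isLinear.Build C (dual A) (dual A) _
  dual_antipode dual_antipode_is_linear.

Definition dual_star phi : dual A :=
  linfun (fun x => (pairing phi (star (antipode x)))^* : C^o).

Lemma pairing_star phi x :
  pairing (dual_star phi) x = (pairing phi (star (antipode x)))^*.
Proof.
pose f (x : A) : C^o := (pairing phi (star (antipode x)))^*.
have f_lin : linear f.
  move=> a y z; by rewrite /f linearP starDZ pairingDr rmorphD rmorphM /= conjCK.
pose F : {linear A -> C^o} := HB.pack f (GRing.isLinear.Build C A C^o _ f f_lin).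
exact: (lfunE F).
Qed.

Fact dual_starDZ (a : C) phi psi :
  dual_star (a *: phi + psi) = a^* *: dual_star phi + dual_star psi.
Proof.
apply: pairing_inj => x.
by rewrite pairingDl !pairing_star pairingDl rmorphD rmorphM.
Qed.
HB.instance Definition _ := hasStar.Build C (dual A) dual_starDZ.
HB.instance Definition _ := hasAntipode.Build C (dual A) dual_antipode.

End DualHopf.

Section Integrals.
Variables (C : numClosedFieldType) (A : preHopfType C).
Implicit Types (a h l r : A) (phi : dual A).

(* phi -> a  =  a_(1) <phi | a_(2)> *)
Definition hit phi a : A := \sw_(a1, a2 <- cop a) (pairing phi a2 *: a1).

Definition d_L a : A := \sw_(a1, a2 <- cop a) (a1 * antipode a2).
Definition d_R a : A := \sw_(a1, a2 <- cop a) (antipode a1 * a2).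

Definition left_integral l := forall a, a * l = d_L a * l.
Definition right_integral r := forall a, r * a = r * d_R a.

Definition haar_integral h :=
  [/\ left_integral h, right_integral h, d_R h = 1 & d_L h = 1].

Definition eval_at a : dual A -> C := fun phi => pairing phi a.

End Integrals.

(* An element of A is positive, resp. nondegenerate, when the functional it
   induces on the dual of A is; an element of the dual of A when it is so as a
   functional on A, the bidual being identified with A. *)
Section Functionals.
Variable C : numClosedFieldType.

Definition positive_functional (B : starAlgType C) (f : B -> C) :=
  forall x, 0 <= f (star x * x).

Definition nondegenerate_functional (B : falgType C) (f : B -> C) :=
  (forall x, (forall y, f (x * y) = 0) -> x = 0) /\
  (forall y, (forall x, f (x * y) = 0) -> y = 0).

End Functionals.

Section SquareRoot.
Variables (C : numClosedFieldType) (A : finCstarType C).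
Implicit Types a b : A.

Definition positive_elt a := exists b, a = star b * b.

(* The positive square root; its value is 0 if a is not positive. *)
Definition psqrt a : A := xget 0 [set b | positive_elt b /\ b * b = a]%classic.

End SquareRoot.

(* Main.v *)
(* Write d = d_R(l) and b for its square root, so that l = h d and e_l = b h b.
   The regular trace tau satisfies tau(x^* x) > 0 for x <> 0, which gives the
   spectral theorem in the form needed here: b is a polynomial in d. Hence b lies
   in A_R, and cop(b h b) = h_1 (x) b h_2 b.
   Since h is a right integral, (h_1 f(h_2)) a = h_1 f(h_2 S(a)) for every
   functional f; for f = lam(b . b) the hypothesis reads h_1 f(h_2) = 1, so that
       a = h_1 lam(b h_2 S(a) b)   for all a.
   This formula makes S injective, hence bijective, then b invertible, and shows
   that phi |-> hit phi l and phi |-> hit phi e_l are onto, hence bijective; all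
   nondegeneracy and uniqueness claims follow. Every x is of the form
   phi(e_1) e_2 with e = e_l, so hit lam x = phi(1_1) 1_2 is fixed by d_L, which
   says that lam is a left integral. Finally, if hit phi l = a, then
   <l | phi^* phi> is the conjugate of lam(w^* w) for w = b^-1 S(a) b. *)
From HB Require Import structures.
Require Import Defs.
From mathcomp Require Import all_boot all_order all_algebra all_field.
From mathcomp Require Import complex.
From mathcomp Require Import boolp classical_sets reals zify.

Set Implicit Arguments.
Unset Strict Implicit.
Unset Printing Implicit Defensive.

Import Order.TTheory GRing.Theory Num.Theory.
Import passmx.

Local Open Scope ring_scope.

(** * Preliminaries: conjugate-linear maps and polynomials in one algebra element *)

Section StarTheory.
Variables (C : numClosedFieldType) (A : starVectType C).
Implicit Types x y : A.

Lemma star0 : star 0 = 0 :> A.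
Proof.
apply: (addrI (star 0)); have := starDZ 1 (0 : A) 0.
by rewrite !addr0 scaler0 rmorph1 scale1r => <-.
Qed.

Lemma starD x y : star (x + y) = star x + star y.
Proof. by rewrite -[x in LHS]scale1r starDZ rmorph1 scale1r. Qed.

Lemma starZ a x : star (a *: x) = a^* *: star x.
Proof. by rewrite -[_ *: _ in LHS]addr0 starDZ star0 addr0. Qed.

Lemma starN x : star (- x) = - star x.
Proof. by rewrite -scaleN1r starZ rmorphN1 scaleN1r. Qed.

Lemma starB x y : star (x - y) = star x - star y.
Proof. by rewrite starD starN. Qed.

End StarTheory.

(** Powers are written with [iter] so that the size can be any [n], such as the dimension of an
    algebra, which is not syntactically a successor. *)
Lemma Cayley_Hamilton_sum (K : fieldType) n (M : 'M[K]_n) :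
  \sum_(i < size (char_poly M)) (char_poly M)`_i *: iter i (mulmx M) 1%:M = 0.
Proof.
case: n M => [|n] M; first by apply/matrixP => -[].
have := Cayley_Hamilton M; rewrite -{1}[char_poly M]coefK poly_def linear_sum /=.
move=> CH; rewrite -[RHS]CH; apply: eq_bigr => i _.
rewrite linearZ /= rmorphXn /= horner_mx_X; congr (_ *: _).
by elim: (i : nat) => [|j IHj] /=; rewrite ?expr0 ?exprS -?mulmxE -?IHj.
Qed.

Lemma horner_alg_sum (K : fieldType) (A : algType K) (x : A) (p : {poly K}) :
  horner_alg x p = \sum_(i < size p) p`_i *: x ^+ i.
Proof.
rewrite -{1}[p]coefK poly_def linear_sum; apply: eq_bigr => i _.
by rewrite linearZ /= rmorphXn /= horner_algX mulr_algl.
Qed.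

Lemma interpolation (K : fieldType) (g : K -> K) (s : seq K) :
  uniq s -> exists q : {poly K}, {in s, forall z, q.[z] = g z}.
Proof.
elim: s => [_|z s IHs /= /andP[zs /IHs[q qE]]]; first by exists 0.
pose p := \prod_(y <- s) ('X - y%:P).
have pz : p.[z] != 0 by rewrite -[_ == 0]/(root p z) root_prod_XsubC.
exists (q + ((g z - q.[z]) / p.[z]) *: p) => y; rewrite inE => /predU1P[->|ys].
  by rewrite !hornerE mulfVK // addrC subrK.
have /eqP py : root p y by rewrite root_prod_XsubC.
by rewrite !hornerE py mulr0 addr0 qE.
Qed.

Lemma horner_alg_comp (K : fieldType) (A : algType K) (x : A) (p q : {poly K}) :
  horner_alg x (p \Po q) = horner_alg (horner_alg x q) p.
Proof.
rewrite comp_polyE linear_sum [RHS]horner_alg_sum; apply: eq_bigr => i _.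
by rewrite linearZ /= rmorphXn /= mulr_algl.
Qed.

(** * The right regular representation and its trace *)

Section Regular.
Variables (K : fieldType) (A : falgType K).
Implicit Types x y : A.

Local Notation e := (vbasis {:A}).

Definition rmulmx x : 'M[K]_(\dim {:A}) := mxof e e (amulr x).

Lemma mul_rmulmx x v : v *m rmulmx x = rVof e (vecof e v * x).
Proof. by rewrite mul_mxof lfunE. Qed.

Lemma rmulmxM x y : rmulmx (x * y) = rmulmx x *m rmulmx y.
Proof. by rewrite /rmulmx rmorphM -(mxof_comp _ _ (vbasisP _)). Qed.

Lemma rmulmx1 : rmulmx 1 = 1%:M.
Proof. by rewrite /rmulmx rmorph1 mxof1 ?(basis_free (vbasisP _)). Qed.

Lemma rmulmxDZ a x y : rmulmx (a *: x + y) = a *: rmulmx x + rmulmx y.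
Proof. by rewrite /rmulmx !linearP. Qed.

Lemma rmulmx_inj : injective rmulmx.
Proof. by move=> x y /(can_inj (mxofK (vbasisP _) (vbasisP _)))/amulr_inj. Qed.

Lemma rmulmxX x n : rmulmx (x ^+ n) = iter n (mulmx (rmulmx x)) 1%:M.
Proof. by elim: n => [|n IHn]; rewrite ?rmulmx1 // exprS rmulmxM IHn. Qed.

Lemma eigenvalue_rmulmx x t :
  eigenvalue (rmulmx x) t -> exists2 v, v * x = t *: v & v != 0.
Proof.
case/eigenvalueP => v vx v0; exists (vecof e v); last by rewrite vecof_eq0 ?vbasisP.
apply: (can_inj (rVofK (vbasisP _))).
by rewrite -mul_rmulmx vx [RHS]linearZ /= vecofK ?vbasisP.
Qed.

Definition regtr x : K := \tr (rmulmx x).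

Lemma regtrC x y : regtr (x * y) = regtr (y * x).
Proof. by rewrite /regtr !rmulmxM mxtrace_mulC. Qed.

Lemma regtrDZ a x y : regtr (a *: x + y) = a * regtr x + regtr y.
Proof. by rewrite /regtr rmulmxDZ linearP. Qed.

Lemma regtrD x y : regtr (x + y) = regtr x + regtr y.
Proof. by have := regtrDZ 1 x y; rewrite scale1r mul1r. Qed.

Lemma regtrZ a x : regtr (a *: x) = a * regtr x.
Proof.
rewrite -[_ *: _]addr0 regtrDZ -[X in _ + X]/(\tr (mxof e e (amulr 0))).
by rewrite !linear0 addr0.
Qed.

(** Injective right multiplication is onto, so some [y] has [y * x = 1]; then [(x * y - 1) * x = 0]
    gives [x * y = 1]. *)
Lemma mulIr_unit x : (forall z, z * x = 0 -> z = 0) -> x \is a GRing.unit.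
Proof.
move=> xreg; have Ux : lker (amulr x) == 0%VS.
  apply/lker0P => y z; rewrite !lfunE /= => yz; apply/subr0_eq/xreg.
  by rewrite mulrBl yz subrr.
have Vx : (amulr x)^-1%VF 1 * x = 1.
  by have := lker0_lfunVK Ux 1; rewrite lfunE.
by apply/unitrP; exists ((amulr x)^-1%VF 1); split=> //; apply/subr0_eq/xreg;
  rewrite mulrBl -mulrA Vx mulr1 mul1r subrr.
Qed.

Lemma annihilating_poly x : exists2 r : {poly K}, r \is monic & horner_alg x r = 0.
Proof.
exists (char_poly (rmulmx x)); first exact: char_poly_monic.
rewrite horner_alg_sum; apply: rmulmx_inj; rewrite /rmulmx !linear0 !linear_sum.
rewrite -[RHS](Cayley_Hamilton_sum (rmulmx x)); apply: eq_bigr => i _.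
by rewrite !linearZ -rmulmxX.
Qed.

End Regular.

(** * Algebraic spectral theory in a finite dimensional C*-algebra *)

Section CstarTheory.
Variables (C : numClosedFieldType) (A : finCstarType C).
Implicit Types x y : A.

Lemma star1 : star 1 = 1 :> A.
Proof. by rewrite -[LHS]mulr1 -[X in _ * X]starK -starM mulr1 starK. Qed.

Lemma star_mul_eq0 x : star x * x = 0 -> x = 0.
Proof.
move=> xx0; apply: cnorm0_eq0; apply/eqP; rewrite -[_ == 0](expf_eq0 _ 2) /=.
by rewrite -cnorm_star xx0 -(scale0r 0) cnormZ normr0 mul0r.
Qed.

Lemma mul_star_eq0 x : x * star x = 0 -> x = 0.
Proof.
by rewrite -{1}[x]starK => /star_mul_eq0/(congr1 star); rewrite starK star0.
Qed.

(** Halving the exponent: for [m] the upper half of [n], the product [star (x ^+ m) * x ^+ m]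
    vanishes, hence so does [x ^+ m], and [m < n] once [n] is at least 2. *)
Lemma selfadjoint_exp_eq0 x n : star x = x -> x ^+ n = 0 -> x = 0.
Proof.
move=> sx; have sX m : star (x ^+ m) = x ^+ m.
  by elim: m => [|m IHm]; rewrite ?star1 // exprSr starM IHm sx -exprS -exprSr.
have [m] := ubnP n; elim: m n => // m IHm [|[|n]] lt_nm.
- by rewrite expr0 => /eqP; rewrite oner_eq0.
- by rewrite expr1.
move=> xn0; have le_n : (n.+2 <= (uphalf n.+2).*2)%N by rewrite uphalfE; lia.
apply: (IHm (uphalf n.+2)); first by move: lt_nm; rewrite uphalfE; lia.
apply: star_mul_eq0; rewrite sX -exprD addnn -(subnK le_n).
by rewrite exprD xn0 mulr0.
Qed.

Lemma selfadjoint_eigenvalue_real x t v :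
  star x = x -> v * x = t *: v -> v != 0 -> t \is Num.real.
Proof.
move=> sx vx v0.
have : star (v * x * star v) = v * x * star v by rewrite !starM starK sx mulrA.
rewrite vx -scalerAl starZ starM starK => /eqP; rewrite -subr_eq0 -scalerBl scaler_eq0.
case/orP => [|/eqP/mul_star_eq0/eqP]; last by rewrite (negPf v0).
by rewrite subr_eq0 => /eqP tt; apply/CrealP.
Qed.

(** Schur triangularization turns the regular matrix of [x] into [T]. Its diagonal entries are
    eigenvalues of [x], hence real, and the trace is the sum of their squares. If it is 0, [T] is
    nilpotent by Cayley-Hamilton, so [x] is nilpotent and self-adjoint, hence 0. *)
Lemma regtr_sqr x : star x = x ->
  0 <= regtr (x * x) /\ (regtr (x * x) = 0 -> x = 0).
Proof.
move=> sx; set n := \dim {:A}; pose M : 'M[C]_n := rmulmx x.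
have n0 : (0 < n)%N by rewrite /n dimvf FalgType_proper.
have [P /unitarymx_unit Pu] := Schur M n0; rewrite /similar_to.
set T := conjmx P M => Ttrig.
have TE : T = P *m M *m invmx P by rewrite /T conjumx.
clearbody T; have MM : M = invmx P *m T *m P.
  by rewrite TE !mulmxA mulVmx // mul1mx mulmxKV.
have trE : regtr (x * x) = \sum_i (T i i) ^+ 2.
  rewrite /regtr rmulmxM -/M {1 2}MM.
  rewrite !mulmxA mulmxK // mxtrace_mulC !mulmxA mulmxV // mul1mx.
  apply: eq_bigr => i _; rewrite mxE (bigD1 i) //= big1 ?addr0 // => j ji.
  have /is_trig_mxP Tt := Ttrig.
  case: (ltngtP i j) => [lt|lt|/val_inj/eqP]; last by rewrite eq_sym (negPf ji).
    by rewrite Tt // mul0r.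
  by rewrite [X in _ * X]Tt // mulr0.
have Treal i : T i i \is Num.real.
  suff /eigenvalue_rmulmx[v] : eigenvalue M (T i i).
    exact: selfadjoint_eigenvalue_real.
  have : eigenvalue T (T i i).
    rewrite eigenvalue_root_char char_poly_trig //.
    by rewrite (bigD1 i) //= rootM root_XsubC eqxx.
  case/eigenvalueP => v vT v0; apply/eigenvalueP; exists (v *m P).
    by rewrite MM !mulmxA mulmxK // vT scalemxAl.
  by apply: contra v0 => /eqP vP; rewrite -(mulmxK Pu v) vP mul0mx.
have T2 i : 0 <= T i i ^+ 2 by rewrite real_exprn_even_ge0.
rewrite trE; split; first exact: sumr_ge0.
move/eqP; rewrite psumr_eq0 // => /allP T0.
have {}T0 i : T i i = 0.
  by apply/eqP; have := T0 i (mem_index_enum _); rewrite expf_eq0.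
apply: (selfadjoint_exp_eq0 (n := n) sx); apply: rmulmx_inj.
rewrite [RHS]/rmulmx !linear0 rmulmxX -/M.
have -> m : iter m (mulmx M) 1%:M = invmx P *m iter m (mulmx T) 1%:M *m P.
  elim: m => [|m IHm] /=; first by rewrite mulmx1 mulVmx.
  by rewrite IHm {1}MM !mulmxA mulmxK.
have := Cayley_Hamilton_sum T; rewrite char_poly_trig //.
rewrite (eq_bigr (fun=> 'X)) => [|i _]; last by rewrite T0 subr0.
rewrite prodr_const card_ord size_polyXn big_ord_recr /= coefXn eqxx scale1r.
rewrite big1 ?add0r => [->|i _]; first by rewrite mulmx0 mul0mx.
by rewrite coefXn ltn_eqF // scale0r.
Qed.

(* The regular trace is tracial, so its value at star x * x is half that
   at star x * x + x * star x, and twice this element is a sum of squares of self-adjoint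
   elements. *)
Lemma regtr_star_mul x :
  0 <= regtr (star x * x) /\ (regtr (star x * x) = 0 -> x = 0).
Proof.
pose p := x + star x; pose q := 'i *: (x - star x).
have sp : star p = p by rewrite starD starK addrC.
have sq : star q = q by rewrite starZ starB starK conjCi scaleNr -scalerN opprB.
have [p_ge0 p0] := regtr_sqr sp; have [q_ge0 q0] := regtr_sqr sq.
have pq : p * p + q * q = 2%:R *: (star x * x) + 2%:R *: (x * star x).
  have -> : p * p = (x * x + star x * star x) + (star x * x + x * star x).
    rewrite mulrDl !mulrDr [X in _ + X = _]addrC addrACA.
    by rewrite [X in _ + X = _]addrC.
  have -> : q * q = - (x * x + star x * star x) + (star x * x + x * star x).
    rewrite -scalerAl -scalerAr scalerA -[in 'i * 'i]expr2 sqrCi scaleN1r.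
    rewrite mulrBl !mulrBr !opprB opprD.
    rewrite [LHS]addrC [x * star x - _]addrC [star x * x - _]addrC addrACA.
    by rewrite [X in _ + X = _]addrC.
  by rewrite addrACA subrr add0r -mulr2n -scaler_nat scalerDr.
have tr4 : regtr (p * p) + regtr (q * q) = 4%:R * regtr (star x * x).
  by rewrite -regtrD pq regtrD !regtrZ (regtrC x) -mulrDl -natrD.
split.
  by rewrite -(pmulr_rge0 _ (ltr0n _ 4)) -tr4 addr_ge0.
move=> tr0; have /eqP := tr4; rewrite tr0 mulr0 paddr_eq0 //.
case/andP => /eqP/p0 pz /eqP/q0 /eqP.
rewrite scaler_eq0 (negPf (neq0Ci _)) subr_eq0 => /eqP qz.
move: pz; rewrite /p -qz -mulr2n => /eqP; rewrite -scaler_nat scaler_eq0 pnatr_eq0 /=.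
by move/eqP.
Qed.

Lemma star_mul_opp_eq0 (t : C) x y : t < 0 -> star x * x = t *: (star y * y) -> y = 0.
Proof.
move=> t_lt0 xy; have [y_ge0 y0] := regtr_star_mul y.
have [x_ge0 _] := regtr_star_mul x.
apply/y0/eqP; rewrite eq_le y_ge0 andbT.
by move: x_ge0; rewrite xy regtrZ nmulr_rge0.
Qed.

Lemma positive_eigenvalue (b : A) t v :
  positive_elt b -> v * b = t *: v -> v != 0 -> 0 <= t.
Proof.
move=> [c bc] vb v0.
have sb : star b = b by rewrite bc starM starK.
(* Both sides equal [v * b * star v]; a negative [t] would contradict [star_mul_opp_eq0]. *)
have vv : star (c * star v) * (c * star v) = t *: (star (star v) * star v).
  by rewrite starM starK !mulrA -[_ * _ * c]mulrA -bc vb scalerAl.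
have vv0 : v * star v != 0 by apply: contra v0 => /eqP/mul_star_eq0->.
have tr : t \is Num.real by exact: selfadjoint_eigenvalue_real sb vb v0.
rewrite real_leNgt // ?real0 //; apply/negP => t_lt0.
move/eqP: v0; apply; apply: (can_inj starK); rewrite star0.
exact: star_mul_opp_eq0 t_lt0 vv.
Qed.

Lemma star_horner_alg (b : A) (p : {poly C}) :
  star (horner_alg b p) = horner_alg (star b) (map_poly Num.conj p).
Proof.
have starX n : star (b ^+ n) = star b ^+ n.
  by elim: n => [|n IHn]; rewrite ?star1 // exprSr starM IHn -exprS.
rewrite !horner_alg_sum size_map_poly star_sum; apply: eq_bigr => i _.
by rewrite coef_map starX.
Qed.

(* A positive element is a root of a polynomial whose roots are nonnegative and
   simple; on these roots, squaring is injective. *)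
Lemma positive_poly_sqr (b : A) :
  positive_elt b -> exists q : {poly C}, b = horner_alg (b * b) q.
Proof.
move=> b_pos.
have sb : star b = b by case: b_pos => c ->; rewrite starM starK.
have [r /monicP r_monic] := annihilating_poly b.
have [s ->] := closed_field_poly_normal r; rewrite r_monic scale1r => bs.
pose f (s : seq C) : {poly C} := \prod_(z <- s) ('X - z%:P).
pose s' := [seq z <- s | 0 <= z]; pose s2 := undup s'.
have s'_ge0 : {in s2, forall z, 0 <= z}.
  by move=> z; rewrite mem_undup mem_filter => /andP[].
have bs' : horner_alg b (f s') = 0.
  rewrite /s' -[LHS]mul1r; move: bs; rewrite -[LHS]mul1r -/(f s).
  elim: s (1 : A) {s' s2 s'_ge0} => //= z s IHs w.
  have fE t : horner_alg b (f (z :: t)) = (b - z%:A) * horner_alg b (f t).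
    by rewrite /f big_cons rmorphM rmorphB /= horner_algX horner_algC.
  rewrite fE mulrA => /IHs ws; case: ifP => z_ge0; first by rewrite fE mulrA.
  move: ws; rewrite -mulrA -fE /f big_cons mulrC rmorphM -/(f _) mulrA.
  rewrite rmorphB /= horner_algX horner_algC.
  move: (w * _) => v; rewrite mulrBr -scalerAr mulr1 => /eqP.
  rewrite subr_eq0 => /eqP vb.
  by apply/eqP; apply: contraFT z_ge0 => /(positive_eigenvalue b_pos vb).
(* Next, repeated roots are removed: [f s'] divides a power of [f s2], so [f s2] takes a nilpotent
   value at [b], self-adjoint because the roots are real. *)
have dvd_f t : {subset t <= s2} -> f t %| f s2 ^+ size t.
  elim: t => [|z t IHt] ts2; first by rewrite /f big_nil dvd1p.
  rewrite /f big_cons exprS dvdp_mul ?dvdp_XsubCl ?root_prod_XsubC ?ts2 ?mem_head //.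
  by apply: IHt => y ty; apply: ts2; rewrite inE ty orbT.
have bs2 : horner_alg b (f s2) = 0.
  apply: (@selfadjoint_exp_eq0 _ (size s')).
    rewrite star_horner_alg sb /f rmorph_prod /=; congr horner_alg.
    apply: eq_big_seq => z /s'_ge0 z_ge0.
    by rewrite rmorphB /= map_polyX map_polyC /= (CrealP (ger0_real z_ge0)).
  rewrite -rmorphXn; have /dvdpP[p ->] := dvd_f s' (fun z => etrans (mem_undup _ _)).
  by rewrite rmorphM /= bs' mulr0.
(* Interpolating the square root at the squares of the roots makes [q \Po 'X^2 - 'X] vanish on the
   simple roots of [f s2]. *)
have [q qE] := interpolation sqrtC (undup_uniq [seq z ^+ 2 | z <- s2]).
exists q; apply/eqP; rewrite eq_sym -subr_eq0.
have <- : horner_alg b (q \Po 'X^2 - 'X) = horner_alg (b * b) q - b.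
  by rewrite rmorphB /= horner_alg_comp horner_algX rmorphXn /= horner_algX.
have /dvdpP[p ->] : f s2 %| q \Po 'X^2 - 'X.
  apply: uniq_roots_dvdp; last by rewrite uniq_rootsE undup_uniq.
  apply/allP => z zs2; rewrite rootE !hornerE horner_comp !hornerE qE.
    by rewrite sqrCK ?s'_ge0 // subrr.
  by rewrite mem_undup (map_f (fun z => z ^+ 2)).
by rewrite rmorphM /= bs2 mulr0.
Qed.

End CstarTheory.

(** * Multilinearity and Sweedler calculus *)

Section Linearity.
Variables (K : fieldType).

Lemma lin_id (V : lmodType K) : linear (fun x : V => x).
Proof. by []. Qed.

Lemma lin_Z (U V : lmodType K) (f : U -> V) a x : linear f -> f (a *: x) = a *: f x.
Proof.
move=> fl; have f0 : f 0 = 0.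
  have := fl 1 0 0; rewrite !scale1r addr0 => /esym/eqP.
  by rewrite -subr_eq0 addrK => /eqP.
by rewrite -[a *: x]addr0 fl f0 addr0.
Qed.

Lemma lin_map (U V W : lmodType K) (g : {linear V -> W}) (f : U -> V) :
  linear f -> linear (fun x => g (f x)).
Proof. by move=> fl a u v; rewrite fl linearP. Qed.

Lemma lin_app (U V W : lmodType K) (g : V -> W) (f : U -> V) :
  linear g -> linear f -> linear (fun x => g (f x)).
Proof. by move=> gl fl a u v; rewrite fl gl. Qed.

Lemma lin_mull (V : lmodType K) (A : algType K) (c : A) (f : V -> A) :
  linear f -> linear (fun x => c * f x).
Proof. by move=> fl a u v; rewrite fl mulrDr scalerAr. Qed.

Lemma lin_mulr (V : lmodType K) (A : lalgType K) (c : A) (f : V -> A) :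
  linear f -> linear (fun x => f x * c).
Proof. by move=> fl a u v; rewrite fl mulrDl scalerAl. Qed.

Lemma lin_scalel (V W : lmodType K) (f : V -> K^o) (w : W) :
  linear f -> linear (fun x => f x *: w).
Proof. by move=> fl a u v; rewrite fl scalerDl scalerA. Qed.

Lemma lin_scaler (V W : lmodType K) (c : K) (f : V -> W) :
  linear f -> linear (fun x => c *: f x).
Proof. by move=> fl a u v; rewrite fl scalerDr !scalerA mulrC. Qed.

Lemma lin_tensorl (V : lmodType K) (U W : vectType K) (f : V -> U) (w : W) :
  linear f -> linear (fun x => f x ⊗ w).
Proof. by move=> fl a u v; rewrite fl tensor_linearl. Qed.

Lemma lin_tensorr (V : lmodType K) (U W : vectType K) (f : V -> W) (u : U) :
  linear f -> linear (fun x => u ⊗ f x).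
Proof. by move=> fl a x y; rewrite fl tensor_linearr. Qed.

Lemma lin_sweedler_tens (V W : lmodType K) (U1 U2 : vectType K)
    (t : V -> tens U1 U2) (F : U1 -> U2 -> W) :
  linear t -> linear (fun x => sweedler (t x) F).
Proof. by move=> tl a u v; rewrite tl sweedler_is_linear. Qed.

Lemma lin_sweedler_fun (V W : lmodType K) (U1 U2 : vectType K)
    (t : tens U1 U2) (F : V -> U1 -> U2 -> W) :
  (forall x y, linear (fun v => F v x y)) -> linear (fun v => \sw_(x, y <- t) F v x y).
Proof.
move=> Fl a u v; rewrite -sweedlerDr; apply: eq_sweedler => x y; exact: Fl.
Qed.

Lemma sweedler_lin (U1 U2 : vectType K) (W W' : lmodType K) (f : W -> W')
    (t : tens U1 U2) (F : U1 -> U2 -> W) :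
  linear f -> f (sweedler t F) = \sw_(x, y <- t) f (F x y).
Proof.
move=> fl.
pose g : {linear W -> W'} := HB.pack f (GRing.isLinear.Build K W W' _ f fl).
exact: (linear_sweedler g).
Qed.

Lemma sweedler_sweedler (U1 U2 V1 V2 : vectType K) (W : lmodType K)
    (t : tens U1 U2) (G : U1 -> U2 -> tens V1 V2) (F : V1 -> V2 -> W) :
  sweedler (\sw_(x, y <- t) G x y) F = \sw_(x, y <- t) sweedler (G x y) F.
Proof.
apply: (sweedler_lin (f := fun t => sweedler t F)) => a u v.
exact: sweedler_is_linear.
Qed.

Lemma tensorZr (U V : vectType K) a (u : U) (v : V) : u ⊗ (a *: v) = a *: (u ⊗ v).
Proof. by apply/matrixP => i j; rewrite !mxE linearZ /= mulrCA. Qed.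

Lemma tensorZl (U V : vectType K) a (u : U) (v : V) : (a *: u) ⊗ v = a *: (u ⊗ v).
Proof. by apply/matrixP => i j; rewrite !mxE linearZ /= mulrA. Qed.

End Linearity.

(** Discharges the linearity side conditions of Sweedler rewriting by descent on the term; the last
    branch handles maps whose linearity is a hypothesis. *)
Ltac lin_tac := intros; cbv beta; repeat first
  [ assumption | exact: lin_id | exact: linearP
  | apply: lin_mull | apply: lin_mulr | apply: lin_scalel | apply: lin_scaler
  | apply: lin_tensorl | apply: lin_tensorr
  | apply: lin_sweedler_tens | apply: lin_sweedler_fun; intros; cbv beta
  | apply: lin_map
  | match goal with
    | H : GRing.linear_for _ ?g |- GRing.linear_for _ (fun x => ?g (@?f x)) =>
        apply: (lin_app (g := g) (f := f)); [exact: H|]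
    end ].

Section Exchange.
Variables (K : fieldType) (U1 U2 V1 V2 : vectType K) (W : lmodType K).

Lemma exchange_sweedler (t : tens U1 U2) (s : tens V1 V2)
    (F : U1 -> U2 -> V1 -> V2 -> W) :
  \sw_(x1, x2 <- t) \sw_(y1, y2 <- s) F x1 x2 y1 y2 =
  \sw_(y1, y2 <- s) \sw_(x1, x2 <- t) F x1 x2 y1 y2.
Proof.
have E (X1 X2 Y1 Y2 : vectType K) (r : tens X1 X2) (q : tens Y1 Y2)
    (G : X1 -> X2 -> Y1 -> Y2 -> W) :
    \sw_(x1, x2 <- r) \sw_(y1, y2 <- q) G x1 x2 y1 y2 =
    \sum_i \sum_k \sum_j \sum_l (r i j * q k l) *:
      G (vbasis {:X1})`_i (vbasis {:X2})`_j (vbasis {:Y1})`_k (vbasis {:Y2})`_l.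
  apply: eq_bigr => i _; rewrite exchange_big; apply: eq_bigr => j _.
  rewrite scaler_sumr; apply: eq_bigr => k _; rewrite scaler_sumr.
  by apply: eq_bigr => l _; rewrite scalerA.
rewrite !E exchange_big; apply: eq_bigr => k _; apply: eq_bigr => i _.
rewrite exchange_big; apply: eq_bigr => l _; apply: eq_bigr => j _.
by rewrite mulrC.
Qed.

Lemma sweedler_tensor3 (U3 : vectType K) (G : U1 -> U2 -> U3 -> W) u1 u2 u3 :
  (forall x y, linear (fun z => G z x y)) -> (forall x y, linear (fun z => G x z y)) ->
  (forall x y, linear (fun z => G x y z)) ->
  \sw_(x, s <- u1 ⊗ (u2 ⊗ u3)) \sw_(y, z <- s) G x y z = G u1 u2 u3.
Proof.
by move=> G1 G2 G3; rewrite !sweedler_tensor //; lin_tac.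
Qed.

End Exchange.

Section CoalgebraTheory.
Variables (K : fieldType) (A : coalgType K) (W : lmodType K).
Variable G : A -> A -> A -> W.
Hypotheses (G1 : forall x y, linear (fun z => G z x y))
  (G2 : forall x y, linear (fun z => G x z y))
  (G3 : forall x y, linear (fun z => G x y z)).

Lemma sweedler_coassoc (a : A) :
  \sw_(x1, x2 <- cop a) \sw_(y1, y2 <- cop x1) G y1 y2 x2 =
  \sw_(x1, x2 <- cop a) \sw_(y1, y2 <- cop x2) G x1 y1 y2.
Proof.
pose L (t : tens A (tens A A)) := \sw_(x, s <- t) \sw_(y, z <- s) G x y z.
have Ll : linear L by rewrite /L; lin_tac.
have := congr1 L (coassoc a); rewrite !(sweedler_lin _ _ Ll) => E.
transitivity (\sw_(x1, x2 <- cop a) L (\sw_(y1, y2 <- cop x1) y1 ⊗ (y2 ⊗ x2))).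
  apply: eq_sweedler => x1 x2; rewrite (sweedler_lin _ _ Ll).
  by apply: eq_sweedler => y1 y2; rewrite /L sweedler_tensor3.
rewrite E; apply: eq_sweedler => x1 x2; rewrite (sweedler_lin _ _ Ll).
by apply: eq_sweedler => y1 y2; rewrite /L sweedler_tensor3.
Qed.

End CoalgebraTheory.

(** * Slices of [cop 1] and their coproducts *)

Section WeakHopfTheory.
Variables (C : numClosedFieldType) (A : weakCstarHopfType C).

Lemma sweedler_copM (W : lmodType C) (F : A -> A -> W) (x y : A) :
  (forall v, linear (F^~ v)) -> (forall u, linear (F u)) ->
  sweedler (cop (x * y)) F =
  \sw_(x1, x2 <- cop x) \sw_(y1, y2 <- cop y) F (x1 * y1) (x2 * y2).
Proof.
move=> Fl Fr; rewrite copM.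
have Ll : linear (fun t : tens A A => sweedler t F) by lin_tac.
rewrite (sweedler_lin _ _ Ll); apply: eq_sweedler => x1 x2.
rewrite (sweedler_lin _ _ Ll); apply: eq_sweedler => y1 y2.
by rewrite sweedler_tensor.
Qed.

Lemma sweedler_cop1 (W : lmodType C) (G : A -> A -> A -> W) :
  (forall x y, linear (fun z => G z x y)) -> (forall x y, linear (fun z => G x z y)) ->
  (forall x y, linear (fun z => G x y z)) ->
  \sw_(a1, a2 <- cop (1 : A)) \sw_(b1, b2 <- cop (1 : A)) G a1 (a2 * b1) b2 =
  \sw_(a1, a2 <- cop (1 : A)) \sw_(b1, b2 <- cop a2) G a1 b1 b2.
Proof.
move=> G1 G2 G3.
pose L (t : tens A (tens A A)) := \sw_(x, s <- t) \sw_(y, z <- s) G x y z.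
have Ll : linear L by rewrite /L; lin_tac.
have := congr1 L (@cop1 C A); rewrite !(sweedler_lin _ _ Ll) => E.
transitivity (\sw_(a1, a2 <- cop (1 : A))
    L (\sw_(b1, b2 <- cop (1 : A)) a1 ⊗ ((a2 * b1) ⊗ b2))).
  apply: eq_sweedler => x1 x2; rewrite (sweedler_lin _ _ Ll).
  by apply: eq_sweedler => y1 y2; rewrite /L sweedler_tensor3.
rewrite E; apply: eq_sweedler => x1 x2; rewrite (sweedler_lin _ _ Ll).
by apply: eq_sweedler => y1 y2; rewrite /L sweedler_tensor3.
Qed.

Implicit Types (a d h x y : A) (f : A -> C^o).

(* As f varies, slice_r f and slice_l f range over A_R and A_L. *)
Definition slice_r f : A := \sw_(u, v <- cop (1 : A)) (f v *: u).
Definition slice_l f : A := \sw_(u, v <- cop (1 : A)) (f u *: v).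

(** Coassociativity turns the coproduct of the first leg of [cop 1] into the threefold coproduct of
    1, which [cop1] factors into two copies of [cop 1]. *)
Lemma cop_slice_r f : linear f ->
  cop (slice_r f) = \sw_(u, v <- cop (1 : A)) (u ⊗ (v * slice_r f)).
Proof.
move=> fl; rewrite {1}/slice_r linear_sweedler.
under eq_sweedler => u v do rewrite linearZ /= -[cop u]sweedlerE
  (sweedler_lin _ _ (lin_scaler _ (@lin_id _ _))).
rewrite (sweedler_coassoc (G := fun x y z => f z *: (x ⊗ y))); try by lin_tac.
rewrite -(sweedler_cop1 (G := fun x y z => f z *: (x ⊗ y))); try by lin_tac.
apply: eq_sweedler => u v; rewrite /slice_r.
rewrite (sweedler_lin (f := fun w => u ⊗ (v * w))); last by lin_tac.
by apply: eq_sweedler => p q; rewrite -scalerAr tensorZr.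
Qed.

Lemma cop_slice_l f : linear f ->
  cop (slice_l f) = \sw_(u, v <- cop (1 : A)) ((slice_l f * u) ⊗ v).
Proof.
move=> fl; rewrite {1}/slice_l linear_sweedler.
under eq_sweedler => u v do rewrite linearZ /= -[cop v]sweedlerE
  (sweedler_lin _ _ (lin_scaler _ (@lin_id _ _))).
rewrite -(sweedler_cop1 (G := fun x y z => f x *: (y ⊗ z))); try by lin_tac.
rewrite exchange_sweedler; apply: eq_sweedler => u v; rewrite /slice_l.
rewrite (sweedler_lin (f := fun w => (w * u) ⊗ v)); last by lin_tac.
by apply: eq_sweedler => p q; rewrite -scalerAl tensorZl.
Qed.

(* Both properties characterize the elements of A_R. *)
Definition right_leg d := forall a, cop (a * d) = \sw_(x, y <- cop a) (x ⊗ (y * d)).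
Definition left_leg d := forall a, cop (d * a) = \sw_(x, y <- cop a) (x ⊗ (d * y)).

Lemma sweedler_right_leg (W : lmodType C) (F : A -> A -> W) d a :
  right_leg d -> (forall v, linear (F^~ v)) -> (forall u, linear (F u)) ->
  sweedler (cop (a * d)) F = \sw_(x, y <- cop a) F x (y * d).
Proof.
move=> dR Fl Fr; rewrite dR.
rewrite sweedler_sweedler.
by apply: eq_sweedler => x y; rewrite sweedler_tensor.
Qed.

Lemma sweedler_left_leg (W : lmodType C) (F : A -> A -> W) d a :
  left_leg d -> (forall v, linear (F^~ v)) -> (forall u, linear (F u)) ->
  sweedler (cop (d * a)) F = \sw_(x, y <- cop a) F x (d * y).
Proof.
move=> dL Fl Fr; rewrite dL.
rewrite sweedler_sweedler.
by apply: eq_sweedler => x y; rewrite sweedler_tensor.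
Qed.

(** For d the slice, cop(ad) = cop(a) cop(d) and cop(d) = cop(1)(1 ⊗ d) by [cop_slice_r], while
    cop(a) cop(1) = cop(a). *)
Lemma slice_r_right_leg f : linear f -> right_leg (slice_r f).
Proof.
move=> fl a; rewrite -[LHS]sweedlerE sweedler_copM; try by lin_tac.
rewrite -{2}[a]mulr1 sweedler_copM; try by lin_tac.
apply: eq_sweedler => x1 x2; rewrite cop_slice_r //.
set F := fun y1 y2 => _.
rewrite sweedler_sweedler.
by apply: eq_sweedler => x y; rewrite /F sweedler_tensor ?mulrA //; lin_tac.
Qed.

Lemma right_leg1 : right_leg 1.
Proof.
move=> a; rewrite mulr1 -[LHS]sweedlerE; apply: eq_sweedler => x y.
by rewrite mulr1.
Qed.

Lemma right_legM d d' : right_leg d -> right_leg d' -> right_leg (d * d').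
Proof.
move=> dR dR' a; rewrite mulrA dR' sweedler_right_leg //; try by lin_tac.
by apply: eq_sweedler => x y; rewrite mulrA.
Qed.

Lemma right_legDZ c d d' : right_leg d -> right_leg d' -> right_leg (c *: d + d').
Proof.
move=> dR dR' a; rewrite mulrDr -scalerAr linearP dR dR' -sweedlerDr.
by apply: eq_sweedler => x y; rewrite mulrDr -scalerAr tensor_linearr.
Qed.

Lemma right_leg_horner d (p : {poly C}) : right_leg d -> right_leg (horner_alg d p).
Proof.
move=> dR; elim/poly_ind: p => [|p c IHp].
  rewrite rmorph0; have := right_legDZ (-1) right_leg1 right_leg1.
  by rewrite scaleN1r addNr.
rewrite rmorphD rmorphM /= horner_algX horner_algC addrC.
exact: right_legDZ right_leg1 (right_legM IHp dR).
Qed.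

End WeakHopfTheory.

(** * The star on Sweedler sums and on A_R *)

Section TensorStar.
Variables (C : numClosedFieldType) (A : starVectType C).

(** Makes [tens A A] a [starVectType], so that [star_sweedler] covers tensor-valued sums. *)
Fact star_tensDZ (a : C) (s t : tens A A) :
  star_tens (a *: s + t) = a^* *: star_tens s + star_tens t.
Proof.
rewrite /star_tens scaler_sumr -big_split; apply: eq_bigr => i _ /=.
rewrite scaler_sumr -big_split; apply: eq_bigr => j _ /=.
by rewrite !mxE rmorphD rmorphM scalerDl scalerA.
Qed.
HB.instance Definition _ := hasStar.Build C (tens A A) star_tensDZ.

Lemma star_sweedler (W : starVectType C) (t : tens A A) (F G : A -> A -> W) :
  (forall v, linear (G^~ v)) -> (forall u, linear (G u)) ->
  (forall x y, star (F x y) = G (star x) (star y)) ->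
  star (sweedler t F) = sweedler (star_tens t) G.
Proof.
move=> Gl Gr FG; rewrite /star_tens.
have Ll : linear (fun t => sweedler t G) by lin_tac.
pose L : {linear tens A A -> W} := HB.pack (fun t : tens A A => sweedler t G)
  (GRing.isLinear.Build C _ W _ (fun t : tens A A => sweedler t G) Ll).
rewrite -[RHS]/(L _) linear_sum (big_morph _ (@starD _ W) (star0 W)).
apply: eq_bigr => i _; rewrite linear_sum (big_morph _ (@starD _ W) (star0 W)).
apply: eq_bigr => j _; rewrite starZ FG linearZ_LR.
by rewrite -[L _]/(sweedler _ _) sweedler_tensor.
Qed.

End TensorStar.

Section WeakHopfStar.
Variables (C : numClosedFieldType) (A : weakCstarHopfType C).
Implicit Types (a d h x y : A) (f : A -> C^o).

Lemma left_leg_star d : right_leg d -> left_leg (star d).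
Proof.
move=> dR a; rewrite -[a in LHS]starK -starM cop_star dR.
rewrite -[star_tens _]/(star _).
rewrite (@star_sweedler _ _ _ _ _ (fun x y => x ⊗ (star d * y))); try by lin_tac.
  by rewrite -cop_star starK.
by move=> x y; rewrite [LHS]star_tensE starM.
Qed.

Definition conj_functional f : A -> C^o := fun x => (f (star x))^*.

Lemma lin_conj_functional f : linear f -> linear (conj_functional f).
Proof.
by move=> fl a x y; rewrite /conj_functional starDZ fl rmorphD rmorphM /= conjCK.
Qed.

Lemma star_slice_r f : linear f -> star (slice_r f) = slice_r (conj_functional f).
Proof.
move=> fl; have fcl := lin_conj_functional fl.
rewrite /slice_r (@star_sweedler _ _ _ _ _ (fun u v => conj_functional f v *: u));
  try by lin_tac.
  by rewrite -cop_star star1.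
by move=> x y; rewrite starZ /conj_functional starK.
Qed.

(* A_R is stable under star, which reverses products: this is how the identity
   (1 (x) cop 1)(cop 1 (x) 1) = cop^2(1), not among the axioms, comes in. *)
Lemma slice_r_left_leg f : linear f -> left_leg (slice_r f).
Proof.
move=> fl; have -> : slice_r f = star (slice_r (conj_functional f)).
  rewrite star_slice_r ; last exact: lin_conj_functional.
  by apply: eq_sweedler => x y; rewrite /conj_functional starK conjCK.
exact/left_leg_star/slice_r_right_leg/lin_conj_functional.
Qed.

End WeakHopfStar.

(** * Integrals in a weak Hopf algebra *)

Section Integrals.
Variables (C : numClosedFieldType) (A : weakCstarHopfType C).
Implicit Types (a d h x y : A) (f : A -> C^o).

Lemma d_R_slice x : d_R x = slice_r (fun y => counit (x * y) : C^o).
Proof. by rewrite /d_R antipodel. Qed.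

Lemma lin_counit_mul x : linear (fun y => counit (x * y) : C^o).
Proof. by apply: lin_map; lin_tac. Qed.

Lemma d_R_right_leg x : right_leg (d_R x).
Proof. by rewrite d_R_slice; apply/slice_r_right_leg/lin_counit_mul. Qed.

(** By [antipoder], [f (d_L y)] is the counit of [slice_r f * y]; as [slice_r f] satisfies
    [left_leg], the counit axiom gives the product. *)
Lemma slice_r_mul f a : linear f ->
  \sw_(x, y <- cop a) (f (d_L y) *: x) = slice_r f * a.
Proof.
move=> fl; rewrite -[RHS]counitr sweedler_left_leg.
- apply: eq_sweedler => x y; congr (_ *: _); rewrite /d_L antipoder.
  rewrite (sweedler_lin _ _ fl) /slice_r.
  rewrite (sweedler_lin (W' := C^o) (f := fun u => counit (u * y) : C^o)).
    apply: (@eq_sweedler _ _ _ C^o) => u v.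
    by rewrite -scalerAl (lin_Z _ _ fl) linearZ [LHS]mulrC.
  by apply: (lin_map (counit : {linear A -> C^o})); lin_tac.
- exact: slice_r_left_leg.
- move=> v; exact: linearP.
- move=> u /=; apply: (lin_scalel (f := fun v => counit v : C^o)).
  by apply: (lin_map (counit : {linear A -> C^o})); lin_tac.
Qed.

(** Write S(a) = d_R(a_1) S(a_2). The factor d_R(a_1) moves into h, where it may be replaced by a_1.
    The coproduct of h a_1 then produces a_2 S(a_3) = d_L(a_2), which [slice_r_mul] turns into left
    multiplication by a slice of cop(1), absorbed through h = h 1. *)
Lemma right_integral_hit h a f : right_integral h -> linear f ->
  (\sw_(x, y <- cop h) (f y *: x)) * a = \sw_(x, y <- cop h) (f (y * antipode a) *: x).
Proof.
move=> hR fl; apply/esym.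
rewrite -(antipodem a).
rewrite -(sweedler_coassoc (G := fun x y z => antipode x * y * antipode z));
  try by lin_tac.
have E1 z w : \sw_(x, y <- cop h) (f (y * (d_R z * antipode w)) *: x) =
   \sw_(x, y <- cop h) \sw_(z1, z2 <- cop z) (f (y * z2 * antipode w) *: (x * z1)).
  have -> : \sw_(x, y <- cop h) (f (y * (d_R z * antipode w)) *: x) =
     \sw_(x, y <- cop (h * d_R z)) (f (y * antipode w) *: x).
    rewrite sweedler_right_leg; try by lin_tac.
      by apply: eq_sweedler => x y; rewrite !mulrA.
    exact: d_R_right_leg.
  rewrite -hR sweedler_copM //; lin_tac.
transitivity (\sw_(z, w <- cop a) \sw_(x, y <- cop h)
    (f (y * (d_R z * antipode w)) *: x)).
  rewrite exchange_sweedler; apply: eq_sweedler => x y.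
  rewrite -(sweedler_lin (f := fun z => f (y * z) *: x)); last by lin_tac.
  congr (f (y * _) *: x); apply: eq_sweedler => z w.
  by rewrite /d_R (sweedler_lin (f := fun u => u * antipode w)) //; lin_tac.
under eq_sweedler do rewrite E1.
rewrite exchange_sweedler.
transitivity (\sw_(x, y <- cop h) (x * (slice_r (fun z => f (y * z)) * a))).
  apply: eq_sweedler => x y.
  rewrite (sweedler_coassoc
    (G := fun z1 z2 w => f (y * z2 * antipode w) *: (x * z1))); try by lin_tac.
  rewrite -slice_r_mul; last by lin_tac.
  rewrite (sweedler_lin (f := fun z => x * z)); last by lin_tac.
  apply: eq_sweedler => z w; rewrite /d_L.
  rewrite -scalerAr (sweedler_lin (f := fun u => f (y * u) *: (x * z)));
    last by lin_tac.
  by apply: eq_sweedler => u v; rewrite mulrA.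
transitivity ((\sw_(x, y <- cop (h * 1)) (f y *: x)) * a).
  rewrite sweedler_copM; try by lin_tac.
  rewrite (sweedler_lin (f := fun z => z * a)); last by lin_tac.
  apply: eq_sweedler => x y; rewrite mulrA; congr (_ * a); rewrite /slice_r.
  rewrite (sweedler_lin (f := fun z => x * z)); last by lin_tac.
  by apply: eq_sweedler => u v; rewrite -scalerAr.
by rewrite mulr1.
Qed.

(** By [cop_slice_l], the left side is [slice_l f * d_L 1], and [d_L 1 = 1] by [antipoder] and the
    counit axiom. *)
Lemma d_L_slice_l f : linear f -> d_L (slice_l f) = slice_l f.
Proof.
move=> fl; rewrite /d_L cop_slice_l // sweedler_sweedler.
transitivity (slice_l f * d_L 1).
  rewrite /d_L (sweedler_lin (f := fun z => slice_l f * z)); last by lin_tac.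
  by apply: eq_sweedler => u v; rewrite sweedler_tensor ?mulrA //; lin_tac.
rewrite /d_L antipoder; under eq_sweedler do rewrite mulr1.
by rewrite counitl mulr1.
Qed.

(** Both sides equal [h * l], computed from either integral property. *)
Lemma left_integral_d_R h l : haar_integral h -> left_integral l -> l = h * d_R l.
Proof.
by case=> _ hR _ dL lL; rewrite -hR lL dL mul1r.
Qed.

End Integrals.

(** * Linear maps between spaces of equal dimension *)

Section FiniteDimension.
Variables (K : fieldType) (U V : vectType K) (f : U -> V).
Hypotheses (fl : linear f) (dimUV : \dim {:U} = \dim {:V}).

Let g : {linear U -> V} := HB.pack f (GRing.isLinear.Build K U V _ f fl).
Let gE x : linfun g x = f x. Proof. exact: lfunE. Qed.

Lemma lin_inj_surj : (forall x, f x = 0 -> x = 0) -> forall y, exists x, f x = y.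
Proof.
move=> f0 y; have kg : lker (linfun g) == 0%VS.
  apply/lker0P => x1 x2; rewrite !gE => e; apply/subr0_eq/f0.
  by rewrite -[f _]/(g _) linearB /= -!gE !gE e subrr.
have : y \in limg (linfun g).
  have -> : limg (linfun g) = fullv.
    apply/eqP; rewrite eqEdim subvf /= limg_dim_eq -?dimUV //.
    by rewrite (eqP kg) capv0.
  exact: memvf.
by case/memv_imgP => x _ ->; exists x; rewrite gE.
Qed.

Lemma lin_surj_inj : (forall y, exists x, f x = y) -> forall x, f x = 0 -> x = 0.
Proof.
move=> fs x fx0; have gfull : limg (linfun g) = fullv.
  apply/eqP; rewrite eqEsubv subvf /=; apply/subvP => y _.
  by have [z <-] := fs y; rewrite -gE memv_img ?memvf.
have := limg_ker_dim (linfun g) fullv; rewrite gfull capfv dimUV.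
move/eqP; rewrite -[X in _ == X]add0n eqn_add2r dimv_eq0 => /eqP k0.
by apply/eqP; rewrite -memv0 -k0 memv_ker gE fx0.
Qed.

End FiniteDimension.

(** * The pairing between an algebra and its dual *)

Section DualTheory.
Variables (C : numClosedFieldType) (A : preHopfType C).
Implicit Types (phi psi : dual A) (x y : A).

Lemma dim_dual : \dim {:dual A} = \dim {:A}.
Proof. by rewrite !dimvf; exact: muln1. Qed.

Lemma dual_of (f : A -> C^o) :
  linear f -> exists phi : dual A, forall x, pairing phi x = f x.
Proof.
move=> fl.
pose g : {linear A -> C^o} := HB.pack f (GRing.isLinear.Build C A C^o _ f fl).
by exists (linfun g) => x; rewrite /pairing lfunE.
Qed.

Lemma lin_pairing phi : linear (fun x => pairing phi x : C^o).
Proof. by move=> a x y; rewrite pairingDr. Qed.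

Lemma pairing_eq0 x : (forall phi, pairing phi x = 0) -> x = 0.
Proof.
move=> x0; rewrite (coord_vbasis (memvf x)) big1 // => i _.
by rewrite -pairing_dual_basis x0 scale0r.
Qed.

Lemma pairing_mul_hit phi psi x : pairing (phi * psi) x = pairing phi (hit psi x).
Proof.
rewrite -[phi * psi]/(dual_mul phi psi) pairing_mul.
rewrite /hit (sweedler_lin _ _ (lin_pairing phi)).
by apply: (@eq_sweedler _ _ _ C^o) => u v; rewrite pairingZr mulrC.
Qed.

Lemma lin_hit x : linear (fun phi => hit phi x).
Proof.
move=> a f g; rewrite /hit -sweedlerDr; apply: eq_sweedler => u v.
by rewrite pairingDl scalerDl scalerA.
Qed.

Lemma lin_hitr phi : linear (hit phi).
Proof. by move=> a u v; rewrite /hit linearP sweedler_is_linear. Qed.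

(** The pairing exchanges product and coproduct and transposes the antipode. This carries the
    integral condition on [lam] over to [A]. *)
Lemma pairing_d_L phi x : pairing (d_L phi) x = pairing phi (d_L x).
Proof.
rewrite /d_L (sweedler_lin (f := fun phi : dual A => pairing phi x : C^o)); last first.
  by move=> a f g; rewrite pairingDl.
rewrite (sweedler_lin _ _ (lin_pairing phi)).
transitivity (\sw_(f, g <- cop phi) \sw_(u, v <- cop x)
    (pairing f u * pairing g (antipode v) : C^o)).
  apply: (@eq_sweedler _ _ _ C^o) => f g.
  rewrite -[f * _]/(dual_mul f (dual_antipode g)) pairing_mul.
  by apply: (@eq_sweedler _ _ _ C^o) => u v; rewrite pairing_antipode.
rewrite exchange_sweedler; apply: (@eq_sweedler _ _ _ C^o) => u v.
exact: pairing_cop.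
Qed.

End DualTheory.

(** * Consequences of [hit lam (b * h * b) = 1] for a self-adjoint [b] in A_R *)

Section DualIntegral.
Variables (C : numClosedFieldType) (A : weakCstarHopfType C).
Variables (h b : A) (lam : dual A).
Hypotheses (hR : right_integral h) (sb : star b = b) (bR : right_leg b).
Hypothesis lam1 : hit lam (b * h * b) = 1.

Let bL : left_leg b. Proof. by rewrite -sb; apply: left_leg_star. Qed.

Let hit_e (phi : dual A) :
  hit phi (b * h * b) = \sw_(x, y <- cop h) (pairing phi (b * y * b) *: x).
Proof.
have pl := lin_pairing phi; rewrite /hit sweedler_right_leg //; try by lin_tac.
by rewrite sweedler_left_leg //; lin_tac.
Qed.

Let recover a : \sw_(x, y <- cop h) (pairing lam (b * (y * antipode a) * b) *: x) = a.
Proof.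
have pl := lin_pairing lam.
rewrite -(right_integral_hit _ (f := fun y => pairing lam (b * y * b)) hR).
  by rewrite -hit_e lam1 mul1r.
by lin_tac.
Qed.

Lemma antipode_surj z : exists a : A, antipode a = z.
Proof.
apply: lin_inj_surj => // [|a a0]; first exact: linearP.
rewrite -(recover a) a0 /sweedler big1 // => i _; rewrite big1 // => j _.
by rewrite mulr0 mulr0 mul0r /pairing linear0 scale0r scaler0.
Qed.

(** If [z * b = 0] and [z] is the antipode of [a], each term of [recover] for [a] contains [z * b],
    so [a = 0]. *)
Lemma sqrt_unit : b \is a GRing.unit.
Proof.
apply: mulIr_unit => z zb; have [a az] := antipode_surj z.
rewrite -az -[a]recover /sweedler big1 ?linear0 // => i _; rewrite big1 // => j _.
by rewrite -!mulrA az zb !mulr0 /pairing linear0 scale0r scaler0.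
Qed.

(** The factor [b^-1 * b^-1] cancels the [b * b] that [h * (b * b)] puts on the second leg, leaving
    [recover]. The formula for [phi] is kept for [positive_lam]. *)
Lemma hit_surj_l a : exists2 phi : dual A,
  (forall z, pairing phi z = pairing lam (b * (z * (b^-1 * b^-1 * antipode a)) * b)) &
  hit phi (h * (b * b)) = a.
Proof.
have pl := lin_pairing lam; have bU := sqrt_unit.
have [|phi phiE] := @dual_of _ A
  (fun z => pairing lam (b * (z * (b^-1 * b^-1 * antipode a)) * b)); first by lin_tac.
exists phi => //; rewrite -[RHS]recover /hit.
have pl' := lin_pairing phi.
rewrite sweedler_right_leg; try by lin_tac.
  apply: eq_sweedler => x y; rewrite phiE; congr (pairing _ _ *: _).
  by rewrite !mulrA !(mulrK bU).
exact: right_legM.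
Qed.

Lemma hit_surj_e a : exists phi : dual A, hit phi (b * h * b) = a.
Proof.
have pl := lin_pairing lam; have bU := sqrt_unit.
have [|phi phiE] := @dual_of _ A
  (fun z => pairing lam (z * b^-1 * antipode a * b)); first by lin_tac.
exists phi; rewrite -[RHS]recover hit_e.
apply: eq_sweedler => x y; rewrite phiE; congr (pairing _ _ *: _).
by rewrite !mulrA !(mulrK bU).
Qed.

Lemma hit_e_inj phi : hit phi (b * h * b) = 0 -> phi = 0.
Proof.
apply: (lin_surj_inj (f := fun phi => hit phi (b * h * b)));
  [exact: lin_hit | exact: dim_dual | exact: hit_surj_e].
Qed.

Lemma hit_e_unique mu : hit mu (b * h * b) = 1 -> mu = lam.
Proof.
move=> mu1; apply/subr0_eq/hit_e_inj.
have := lin_hit (b * h * b) (-1) lam mu; rewrite mu1 lam1 !scaleN1r addNr addrC.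
by [].
Qed.

(** By [pairing_mul_hit], the two halves are the surjectivity and the injectivity of hitting
    [h * (b * b)]. *)
Lemma nondegenerate_l : nondegenerate_functional (eval_at (h * (b * b))).
Proof.
split=> x x0.
  apply: pairing_inj => a; have [phi _ <-] := hit_surj_l a.
  by rewrite -pairing_mul_hit [LHS]x0 /pairing [RHS]zero_lfunE.
have {}x0 : hit x (h * (b * b)) = 0.
  by apply: pairing_eq0 => phi; rewrite -pairing_mul_hit [LHS]x0.
move: x0; apply: (lin_surj_inj (f := fun phi => hit phi (h * (b * b))));
  [exact: lin_hit | exact: dim_dual | ].
by move=> a; have [phi _ <-] := hit_surj_l a; exists phi.
Qed.

Lemma hit_slice x : exists2 f : A -> C^o, linear f & hit lam x = slice_l f.
Proof.
have pl := lin_pairing lam.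
(* With e = b h b, the map sending phi to phi(e_1) e_2 is the transpose of hitting e; it is
   injective because the latter is onto. *)
have [phi <-] : exists phi : dual A,
    \sw_(u, v <- cop (b * h * b)) (pairing phi u *: v) = x.
  apply: lin_inj_surj; [| exact: dim_dual |].
    move=> a f g; rewrite -sweedlerDr; apply: eq_sweedler => u v.
    by rewrite pairingDl scalerDl scalerA.
  move=> phi phi0; apply: pairing_inj => a; have [psi <-] := hit_surj_e a.
  have lp := lin_pairing phi; have := congr1 (pairing psi) phi0.
  rewrite (sweedler_lin _ _ (lin_pairing psi)) /hit (sweedler_lin _ _ lp).
  rewrite /pairing linear0 zero_lfunE => E; rewrite -[RHS]E.
  by apply: (@eq_sweedler _ _ _ C^o) => u v; rewrite !linearZ [LHS]mulrC.
have lp := lin_pairing phi; exists (pairing phi) => //.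
rewrite (sweedler_lin _ _ (lin_hitr lam)).
transitivity (\sw_(u, v <- cop (b * h * b)) \sw_(p, q <- cop v)
    (pairing lam q *: (pairing phi u *: p))).
  apply: eq_sweedler => u v.
  rewrite (lin_Z _ _ (lin_hitr lam)) /hit.
  rewrite (sweedler_lin (f := fun z => pairing phi u *: z)); last by lin_tac.
  by apply: eq_sweedler => p q; rewrite !scalerA mulrC.
(* By coassociativity, phi(e_1) e_2 lam(e_3) is the slice by phi of the coproduct of [hit lam e],
   which is 1. *)
rewrite -(sweedler_coassoc
  (G := fun u p q => pairing lam q *: (pairing phi u *: p))); try by lin_tac.
rewrite /slice_l -lam1 /hit linear_sweedler sweedler_sweedler.
apply: eq_sweedler => u v.
rewrite linearZ /= (lin_Z (f := fun t => sweedler t _)); last exact: sweedler_is_linear.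
by rewrite [RHS](sweedler_lin (f := fun z => pairing lam v *: z)) //; lin_tac.
Qed.

Lemma left_integral_lam : left_integral lam.
Proof.
move=> phi; apply: pairing_inj => x; rewrite !pairing_mul_hit pairing_d_L.
by have [f fl ->] := hit_slice x; rewrite d_L_slice_l.
Qed.

Lemma star_invr : star b^-1 = b^-1.
Proof.
apply: (mulrI sqrt_unit); rewrite divrr ?sqrt_unit //.
by rewrite -{1}sb -starM mulVr ?sqrt_unit // star1.
Qed.

Lemma positive_lam :
  positive_functional (eval_at (h * (b * b))) -> positive_functional (pairing lam).
Proof.
move=> lpos w; have bU := sqrt_unit.
have [a aE] := antipode_surj (b * w * b^-1).
have [phi phiE hphi] := hit_surj_l a.
have := lpos phi; rewrite /eval_at pairing_mul_hit hphi.
rewrite -[star phi]/(dual_star phi) pairing_star conjC_ge0 phiE aE !starM star_invr sb.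
by rewrite !mulrA (divrr bU) mul1r !(mulrK bU) !(mulrVK bU).
Qed.

Lemma nondegenerate_lam : nondegenerate_functional (pairing lam).
Proof.
have pl := lin_pairing lam; have bU := sqrt_unit.
have inj y : (forall x, pairing lam (x * y) = 0) -> y = 0.
  (* Since S(a) b = y, every coefficient in [recover] for [a] is a value of [lam] at a left multiple
     of [y]. *)
  move=> y0; have [a aE] := antipode_surj (y * b^-1).
  have a0 : a = 0.
    rewrite -[a]recover /sweedler big1 // => i _; rewrite big1 // => j _.
    by rewrite aE -!mulrA (mulVr bU) mulr1 !mulrA y0 scale0r scaler0.
  by rewrite -[y](mulrVK bU) -aE a0 linear0 mul0r.
split=> // x x0; apply: pairing_eq0 => phi.
(* The map sending y to the functional lam(. y) is injective by [inj], hence onto the dual, so every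
   functional vanishes at [x]. *)
have [Y YE] : exists Y : A -> dual A, forall y x, pairing (Y y) x = pairing lam (x * y).
  have E y : exists psi : dual A, forall x, pairing psi x = pairing lam (x * y).
    by apply: dual_of; lin_tac.
  by exists (fun y => sval (cid (E y))) => y; exact: svalP (cid (E y)).
have [y <-] : exists y, Y y = phi; last by rewrite YE.
apply: (lin_inj_surj (f := Y)).
- move=> a u v; apply: pairing_inj => z.
  by rewrite pairingDl !YE mulrDr -scalerAr pairingDr.
- by rewrite dim_dual.
- by move=> y Y0; apply: inj => z; rewrite -YE Y0 /pairing [LHS]zero_lfunE.
Qed.

End DualIntegral.

(** * Specialization to the square root of [d_R l] *)

Lemma psqrtP (C : numClosedFieldType) (A : finCstarType C) (a : A) :
  psqrt a <> 0 -> positive_elt (psqrt a) /\ psqrt a * psqrt a = a.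
Proof. by rewrite /psqrt; case: xgetP => [b -> []|]. Qed.

Theorem proposition3p3p2 (R : realType) (A : weakCstarHopfType (complex R))
    (h l : A) (lam : dual A) :
  haar_integral h ->
  left_integral l ->
  positive_functional (eval_at l) ->
  let e_l := psqrt (d_R l) * h * psqrt (d_R l) in
  hit lam e_l = 1 ->
  [/\ nondegenerate_functional (eval_at l),
      forall mu : dual A, hit mu e_l = 1 -> mu = lam,
      left_integral lam,
      positive_functional (pairing lam)
    & nondegenerate_functional (pairing lam)].
Proof.
move=> hH lL lpos e_l; rewrite /e_l => lam1; set b := psqrt (d_R l) in lam1 *.
(* If [psqrt] returned 0, in particular as its default, then [e_l = 0], contradicting
   [hit lam e_l = 1]. *)
have [|b_pos bb] := @psqrtP _ A (d_R l).
  rewrite -/b => b0; move: lam1; rewrite b0 mulr0 /hit linear0.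
  rewrite /sweedler big1 => [/esym/eqP|i _]; first by rewrite oner_eq0.
  by rewrite big1 // => j _; rewrite mxE scale0r.
rewrite -/b in b_pos bb.
have sb : star b = b by case: b_pos => c ->; rewrite starM starK.
have bR : right_leg b.
  have [q ->] := positive_poly_sqr b_pos; apply: right_leg_horner.
  by rewrite bb; apply: d_R_right_leg.
have lE : l = h * (b * b) by rewrite bb; apply: left_integral_d_R.
have hR : right_integral h by case: hH.
split.
- by rewrite lE; apply: nondegenerate_l lam1.
- by move=> mu; apply: hit_e_unique lam1 _.
- exact: left_integral_lam lam1.
- by apply: positive_lam lam1 _ => //; rewrite -lE.
- exact: nondegenerate_lam lam1.
Qed.
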